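(* Let $\alpha\in(0,1)$, $T>0$, $r\in(0,2]$, $a\in(0,r]$. Let $(\omega_\beta(h))_{\beta\in\mathbb{Z}^d\setminus\{0\},\,h>0}$ be weights such that, for every $h>0$, $\omega_\beta(h)=\omega_{-\beta}(h)\ge 0$ for all $\beta$ and $\sum_{\beta\neq0}\omega_\beta(h)<+\infty$, and such that $\sup_{h\in(0,1)}\sum_{\beta\neq0}\min\{|\beta h|^r,1\}\,\omega_\beta(h)<C_r$ for some $C_r>0$. Let $u_0\in X^a_b(\mathbb{R}^d)$ and let $D\in C_b([0,T]:X^r_b(\mathbb{R}^d))\cap C_b(\mathbb{R}^d:\mathrm{Lip}([0,T]))$ be nonnegative. For $h,\tau>0$ let $(U^n)_n$ be the solution of $\partial_\tau^\alpha U^n(x)=D(x,t_n)L_hU^n(x)$, $n\ge1$, with $U^0=u_0$, and let $U=U_{h,\tau}:\mathbb{R}^d\times[0,T]\to\mathbb{R}$ be its piecewise linear interpolation in time. Then there exist a function $u\in C_b(\mathbb{R}^d\times[0,T])$ and a sequence $(h_j,\tau_j)\to(0,0)$ (with $h_j,\tau_j>0$) as $j\to\infty$ such that $$U_{h_j,\tau_j}\to u\quad\text{locally uniformly in }\mathbb{R}^d\times[0,T]\text{ as }j\to\infty.$$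
   Context: $d\in\mathbb{N}$; $\|\cdot\|_{L^\infty}$ is the supremum norm; solutions $U^n$ of the scheme are understood to be bounded functions defined everywhere on $\mathbb{R}^d$ (they exist and are unique). For $r\in(0,2]$, $X^r_b(\mathbb{R}^d)$ is the space of functions with finite norm $\|\phi\|_{X^r}=\|\phi\|_{L^\infty}+\sup_{x\ne y}\frac{|\phi(x)-\phi(y)|}{|x-y|^r}$ if $r\in(0,1]$, and $\|\phi\|_{X^r}=\|\phi\|_{L^\infty}+\sup_{x\neq y}\frac{|\phi(x)-\phi(y)|}{|x-y|}+\sup_{x\ne y}\frac{|\nabla\phi(x)-\nabla\phi(y)|}{|x-y|^{r-1}}$ if $r\in(1,2]$. $C_b([0,T]:X)$ denotes bounded continuous functions of $t\in[0,T]$ with values in $X$ (here $t\mapsto D(\cdot,t)$), and $C_b(\mathbb{R}^d:\mathrm{Lip}([0,T]))$ bounded continuous functions of $x$ with values in the Lipschitz functions of $t$. Time grid: $t_n=n\tau$. Discrete (L1) Caputo derivative: for $n\ge1$, $\partial_\tau^\alpha v^n=\frac{\tau^{-\alpha}}{\Gamma(2-\alpha)}\Big(v^n-b_{n-1}v^0-\sum_{k=1}^{n-1}(b_{n-k-1}-b_{n-k})v^k\Big)$, $b_i=(i+1)^{1-\alpha}-i^{1-\alpha}$. $L_h\psi(x)=\sum_{\beta\in\mathbb{Z}^d\setminus\{0\}}\big(\psi(x+h\beta)+\psi(x-h\beta)-2\psi(x)\big)\omega_\beta(h)$. Interpolation: $U(x,t)=\frac{t_{k+1}-t}{\tau}U^k(x)+\frac{t-t_k}{\tau}U^{k+1}(x)$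 for $t\in[t_k,t_{k+1}]$. If $T/\tau$ is not an integer, the scheme is continued up to the first grid time $\ge T$, with $D(x,t):=D(x,T)$ for $t>T$. *)

(* Defs.v *)
From HB Require Import structures.
From mathcomp Require Import all_boot all_order all_algebra.
From mathcomp Require Import all_classical all_reals all_analysis.

Set Implicit Arguments.
Unset Strict Implicit.
Unset Printing Implicit Defensive.

Import Order.TTheory GRing.Theory Num.Theory.
Import numFieldNormedType.Exports.

Local Open Scope classical_set_scope.
Local Open Scope ring_scope.

(* The library's norm on row vectors is the max norm, whose topology is the
   Euclidean one; the difference quotients and weights below use this
   Euclidean norm. *)
Definition enorm (R : realType) (d : nat) (x : 'rV[R]_d) : R :=
  Num.sqrt (\sum_(i < d) x 0 i ^+ 2).

Definition grad (R : realType) (d : nat) (phi : 'rV[R]_d -> R)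
    (x : 'rV[R]_d) : 'rV[R]_d :=
  \row_(i < d) 'D_(delta_mx 0 i) phi x.

Definition sup_norm (R : realType) (X : Type) (A : set X) (f : X -> R) : \bar R :=
  ereal_sup [set (`|f x|)%:E | x in A].

(* sup of osc x y / (dist x y)^s over distinct x, y in A *)
Definition quotient_sup (R : realType) (X : Type) (A : set X)
    (osc dist : X -> X -> R) (s : R) : \bar R :=
  ereal_sup [set (osc z.1 z.2 / dist z.1 z.2 `^ s)%:E |
              z in [set z : X * X | [/\ A z.1, A z.2 & z.1 <> z.2]]].

(* For 1 < r this is the intended norm only on differentiable functions, since
   'D_v is a default value elsewhere; differentiability is part of Xspace. *)
Definition Xnorm (R : realType) (d : nat) (r : R) (phi : 'rV[R]_d -> R) : \bar R :=
  let dist x y := enorm (x - y) in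
  let osc x y := `|phi x - phi y| in
  let gosc x y := enorm (grad phi x - grad phi y) in
  if r <= 1 then
    (sup_norm setT phi + quotient_sup setT osc dist r)%E
  else
    (sup_norm setT phi + quotient_sup setT osc dist 1%R
     + quotient_sup setT gosc dist (r - 1)%R)%E.

Definition Xspace (R : realType) (d : nat) (r : R) (phi : 'rV[R]_d -> R) : Prop :=
  (1 < r -> forall x, differentiable phi x) /\ (Xnorm r phi < +oo)%E.

Definition Lipnorm (R : realType) (T : R) (f : R -> R) : \bar R :=
  (sup_norm `[0%R, T] f
   + quotient_sup `[0%R, T] (fun t s => `|f t - f s|%R)
       (fun t s => `|t - s|%R) 1%R)%E.

(* t |-> D(., t) belongs to C_b([0,T] : X^r_b(R^d)) *)
Definition Cb_time_X (R : realType) (d : nat) (T r : R)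
    (D : 'rV[R]_d -> R -> R) : Prop :=
  [/\ forall t, t \in `[0, T] -> Xspace r (D^~ t),
      (ereal_sup [set Xnorm r (D^~ t) | t in `[0%R, T]] < +oo)%E &
      forall s, s \in `[0, T] ->
        Xnorm r (fun x => D x t - D x s) @[t --> within `[0, T] (nbhs s)]
          --> 0%E].

(* x |-> D(x, .) belongs to C_b(R^d : Lip([0,T])) *)
Definition Cb_space_Lip (R : realType) (d : nat) (T : R)
    (D : 'rV[R]_d -> R -> R) : Prop :=
  [/\ forall x, (Lipnorm T (D x) < +oo)%E,
      (ereal_sup [set Lipnorm T (D x) | x in setT] < +oo)%E &
      forall y : 'rV[R]_d,
        Lipnorm T (fun t => D x t - D y t) @[x --> y] --> 0%E].

Definition Gamma (R : realType) (z : R) : R :=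
  \int[lebesgue_measure]_(x in `]0%R, +oo[) (x `^ (z - 1) * expR (- x)).

Definition L1_coef (R : realType) (alpha : R) (i : nat) : R :=
  i.+1%:R `^ (1 - alpha) - i%:R `^ (1 - alpha).

(* only meaningful for 1 <= n *)
Definition caputo_L1 (R : realType) (alpha tau : R) (v : nat -> R) (n : nat) : R :=
  tau `^ (- alpha) / Gamma (2 - alpha) *
  (v n - L1_coef alpha (n - 1) * v 0%N
   - \sum_(1 <= k < n)
       (L1_coef alpha (n - k - 1) - L1_coef alpha (n - k)) * v k).

Definition nonzero_lattice (d : nat) : set 'rV[int]_d := [set b | b != 0].
Arguments nonzero_lattice : clear implicits.

(* \esum is meant for nonnegative terms, so the (absolutely convergent) series
   of signed terms is the difference of the sums of its two parts. *)
Definition lattice_sum (R : realType) (d : nat) (f : 'rV[int]_d -> R) : R :=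
  fine (\esum_(b in nonzero_lattice d) (EFin \o f)^\+ b
        - \esum_(b in nonzero_lattice d) (EFin \o f)^\- b)%E.

Definition lattice_pt (R : realType) (d : nat) (h : R) (b : 'rV[int]_d) : 'rV[R]_d :=
  h *: map_mx intr b.

(* w stands for the weights omega(h) at mesh size h *)
Definition discrete_op (R : realType) (d : nat) (h : R) (w : 'rV[int]_d -> R)
    (psi : 'rV[R]_d -> R) (x : 'rV[R]_d) : R :=
  lattice_sum (fun b =>
    (psi (x + lattice_pt h b) + psi (x - lattice_pt h b) - 2 * psi x) * w b).

(* V solves the scheme up to the first grid time n * tau >= T; the condition
   (n - 1) * tau < T selects exactly these n, and D(x,t) := D(x,T) for t > T. *)
Definition scheme_solution (R : realType) (d : nat) (alpha T h tau : R)
    (w : 'rV[int]_d -> R) (D : 'rV[R]_d -> R -> R) (u0 : 'rV[R]_d -> R)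
    (V : nat -> 'rV[R]_d -> R) : Prop :=
  V 0%N = u0 /\
  forall n : nat, (1 <= n)%N -> (n - 1)%N%:R * tau < T ->
    (sup_norm setT (V n) < +oo)%E /\
    forall x, caputo_L1 alpha tau (fun k => V k x) n
              = D x (Num.min (n%:R * tau) T) * discrete_op h w (V n) x.

Definition time_interp (R : realType) (d : nat) (tau : R)
    (V : nat -> 'rV[R]_d -> R) (z : 'rV[R]_d * R) : R :=
  let k := Num.truncn (z.2 / tau) in
  (k.+1%:R * tau - z.2) / tau * V k z.1 + (z.2 - k%:R * tau) / tau * V k.+1 z.1.

Definition slab (R : realType) (d : nat) (T : R) : set ('rV[R]_d * R) :=
  setT `*` `[0, T].
Arguments slab {R} d T.

Definition Cb_on (R : realType) (X : topologicalType) (A : set X) (f : X -> R) : Prop :=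
  {within A, continuous f} /\ (sup_norm A f < +oo)%E.

Definition cvg_locally_uniformly (R : realType) (X : topologicalType) (A : set X)
    (F : nat -> X -> R) (f : X -> R) : Prop :=
  forall z, A z -> exists2 V, nbhs z V & {uniform V `&` A, F @ \oo --> f}.

(* Main.v *)
Require Import Defs.
From HB Require Import structures.
From mathcomp Require Import all_boot all_order all_algebra.
From mathcomp Require Import all_classical all_reals all_analysis.
From mathcomp Require Import measurable_realfun.
From mathcomp Require Import ring lra zify.

Set Implicit Arguments.
Unset Strict Implicit.
Unset Printing Implicit Defensive.

Import Order.TTheory GRing.Theory Num.Theory.
Import numFieldNormedType.Exports.

Local Open Scope classical_set_scope.
Local Open Scope ring_scope.

(* Uniform boundedness and equicontinuity in (h, tau), then Ascoli.
   If V solves the scheme then L V, where L = L_h, solves the dual equation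
   d^alpha (L V) = L (D L V). Since D >= 0 and L D is bounded uniformly in h < 1,
   the maximum principle bounds L V by its initial value. Hence d^alpha V = D L V is
   bounded, which gives a modulus of continuity in time, and a translation difference
   V(. + p) - V solves the scheme up to the small source (D(. + p) - D) L V, which
   gives a modulus in space.
   This needs L u0 bounded. A general u0 is first replaced by a C^{1,1} double
   inf/sup-convolution, and the L^infinity stability of the scheme controls the error. *)

(** * Weighted lattice sums *)

(** Each [U^n] is only known to be bounded, so suprema over the whole space need not be attained.
    The maximum principle is therefore used in the form of a bound on [D * L f + K * f], with [K] at
    least the diagonal rate of the operator: only nonnegative coefficients remain, and [K] cancels
    once the supremum is taken. That rate is finite for each h but is not controlled as h -> 0, so
    no final constant may depend on [K]. The moduli obtained have the form eps + L (|x - y|^2 + |t -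
    s|), with [L] depending on eps: the regularization of [u0] and the length of the memory windows
    are chosen after eps, and the bound holds only for tau below a threshold that also depends on
    eps. Such asymptotic equicontinuity is what the Ascoli argument takes as input. The solution [U]
    is given for the datum [u0] alone, so the solution [V] started from the regularized datum has to
    be constructed. *)

Definition fbounded (R : realType) (X : Type) (f : X -> R) : Prop :=
  exists M, forall x, `|f x| <= M.

Lemma fbounded_ge0 (R : realType) (X : Type) (f : X -> R) :
  fbounded f -> exists2 M, 0 <= M & forall x, `|f x| <= M.
Proof.
by case=> M fM; exists (Num.max M 0); rewrite ?le_max ?lexx ?orbT// => x;
  rewrite le_max fM.
Qed.

Lemma fboundedD (R : realType) (X : Type) (f g : X -> R) :
  fbounded f -> fbounded g -> fbounded (fun x => f x + g x).
Proof.
move=> [M fM] [N gN]; exists (M + N) => x.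
by apply: le_trans (ler_normD _ _) _; apply: lerD.
Qed.

Lemma fboundedM (R : realType) (X : Type) (f g : X -> R) :
  fbounded f -> fbounded g -> fbounded (fun x => f x * g x).
Proof.
move=> [M fM] [N gN]; exists (M * N) => x.
by rewrite normrM ler_pM.
Qed.

Lemma fbounded_cst (R : realType) (X : Type) (c : R) :
  fbounded (fun _ : X => c).
Proof. by exists `|c|. Qed.

Lemma fboundedN (R : realType) (X : Type) (f : X -> R) :
  fbounded f -> fbounded (fun x => - f x).
Proof. by move=> [M fM]; exists M => x; rewrite normrN. Qed.

Lemma fboundedB (R : realType) (X : Type) (f g : X -> R) :
  fbounded f -> fbounded g -> fbounded (fun x => f x - g x).
Proof. by move=> bf bg; apply: fboundedD => //; exact: fboundedN. Qed.

Lemma fbounded_comp (R : realType) (X Y : Type) (f : X -> R) (k : Y -> X) :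
  fbounded f -> fbounded (fun y => f (k y)).
Proof. by move=> [M fM]; exists M. Qed.

Lemma fbounded_sum (R : realType) (X I : Type) (r : seq I) (P : pred I)
    (f : I -> X -> R) :
  (forall i, P i -> fbounded (f i)) ->
  fbounded (fun x => \sum_(i <- r | P i) f i x).
Proof.
move=> bf; elim: r => [|i r IH].
  by exists 0 => x; rewrite big_nil normr0.
have [Pi|nPi] := boolP (P i).
  have [M HM] := fboundedD (bf i Pi) IH.
  by exists M => x; rewrite big_cons Pi.
by case: IH => M HM; exists M => x; rewrite big_cons (negPf nPi).
Qed.

Lemma fbounded_sup_norm (R : realType) (X : Type) (f : X -> R) :
  (sup_norm setT f < +oo)%E -> fbounded f.
Proof.
move=> h; have ub x : (`|f x|%:E <= sup_norm setT f)%E.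
  by apply: ereal_sup_ubound; exists x.
have [x0|nx] := pselect (exists x : X, True); last first.
  by exists 0 => x; exfalso; apply: nx; exists x.
case: x0 => x0 _.
have fin : sup_norm setT f \is a fin_num.
  by rewrite ge0_fin_numE// (le_trans _ (ub x0)).
by exists (fine (sup_norm setT f)) => x; rewrite -lee_fin fineK.
Qed.

Section weighted_sum.
Variables (R : realType) (d : nat) (w : 'rV[int]_d -> R).
Hypothesis w_ge0 : forall b, b != 0 -> 0 <= w b.
Hypothesis w_fin : (\esum_(b in nonzero_lattice d) (w b)%:E < +oo)%E.
Implicit Types f g : 'rV[int]_d -> R.

Definition wsum f : R := lattice_sum (fun b => f b * w b).

Notation nneg f := (forall b : 'rV[int]_d, 0 <= f b).

Lemma esum_wsum_lty f : nneg f -> fbounded f ->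
  (\esum_(b in nonzero_lattice d) (f b * w b)%:E < +oo)%E.
Proof.
move=> f0 /fbounded_ge0[M M0 fM]; pose n := (Num.truncn M).+1.
apply: (@le_lt_trans _ _ (\sum_(i < n) \esum_(b in nonzero_lattice d) (w b)%:E)%E).
  rewrite -esum_sum; last by move=> b i /w_ge0; rewrite lee_fin.
  apply: le_esum => b /w_ge0 wb; rewrite sumEFin lee_fin sumr_const card_ord.
  rewrite -[leRHS]mulr_natl ler_wpM2r//.
  have /andP[_ /ltW Mn] := truncn_itv M0.
  by apply: le_trans Mn; exact: le_trans (ler_norm _) (fM _).
by apply: lte_sum_pinfty => i _.
Qed.

Lemma summable_wsum f : nneg f -> fbounded f ->
  summable (nonzero_lattice d) (EFin \o (fun b => f b * w b)).
Proof.
move=> f0 bf; rewrite /summable.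
under eq_esum => b bn.
  rewrite /= ger0_norm ?mulr_ge0 ?f0 ?w_ge0//; over.
exact: esum_wsum_lty.
Qed.

Lemma esum_wsum_fin f : nneg f -> fbounded f ->
  \esum_(b in nonzero_lattice d) (f b * w b)%:E \is a fin_num.
Proof.
move=> f0 bf; rewrite ge0_fin_numE ?esum_wsum_lty//.
by apply: esum_ge0 => b /w_ge0 wb; rewrite lee_fin mulr_ge0.
Qed.

Lemma wsum_diff f g : nneg f -> nneg g -> fbounded f -> fbounded g ->
  wsum (fun b => f b - g b) =
  fine (\esum_(b in nonzero_lattice d) (f b * w b)%:E) -
  fine (\esum_(b in nonzero_lattice d) (g b * w b)%:E).
Proof.
move=> f0 g0 bf bg.
have E := esumB (summable_wsum f0 bf) (summable_wsum g0 bg).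
rewrite -fineB ?esum_wsum_fin// -E; last 2 first.
- by move=> b /w_ge0 wb; rewrite /= lee_fin mulr_ge0.
- by move=> b /w_ge0 wb; rewrite /= lee_fin mulr_ge0.
rewrite /wsum /lattice_sum; set F := EFin \o _; set G := (_ \- _)%E.
suff -> : F = G by [].
by apply/funext => b; rewrite /F /G /= mulrBl EFinB.
Qed.

Lemma wsum_nneg f : nneg f -> fbounded f ->
  wsum f = fine (\esum_(b in nonzero_lattice d) (f b * w b)%:E).
Proof.
move=> f0 bf.
have z0 (b : 'rV[int]_d) : (0 : R) <= 0 by [].
have := wsum_diff f0 z0 bf (fbounded_cst _ _).
rewrite [X in _ - fine X]esum1 ?subr0; last by move=> b _; rewrite mul0r.
by move=> <-; congr wsum; apply/funext => b; rewrite subr0.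
Qed.

Lemma wsum_nnegD f g : nneg f -> nneg g -> fbounded f -> fbounded g ->
  wsum (fun b => f b + g b) = wsum f + wsum g.
Proof.
move=> f0 g0 bf bg; rewrite !wsum_nneg//; last 2 first.
- by move=> b; rewrite addr_ge0.
- exact: fboundedD.
rewrite -fineD ?esum_wsum_fin// -esumD; last 2 first.
- by move=> b /w_ge0 wb; rewrite lee_fin mulr_ge0.
- by move=> b /w_ge0 wb; rewrite lee_fin mulr_ge0.
by congr fine; apply: eq_esum => b _; rewrite mulrDl EFinD.
Qed.

Lemma wsumB_nneg f g : nneg f -> nneg g -> fbounded f -> fbounded g ->
  wsum (fun b => f b - g b) = wsum f - wsum g.
Proof. by move=> f0 g0 bf bg; rewrite wsum_diff// !wsum_nneg. Qed.

(** Shifting by a bound [M] yields two bounded nonnegative functions at once, which reduces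
    linearity to the nonnegative case. *)
Let split_nneg f : fbounded f -> exists f1 f2,
  [/\ nneg f1, nneg f2, fbounded f1, fbounded f2 & f = fun b => f1 b - f2 b].
Proof.
case=> M fM; exists (fun b => f b + M), (fun=> M); split.
- by move=> b; have := fM b; rewrite ler_norml => /andP[]; lra.
- by move=> b; exact: le_trans (fM b).
- by apply: fboundedD; [exists M | exact: fbounded_cst].
- exact: fbounded_cst.
- by apply/funext => b; rewrite addrK.
Qed.

Lemma wsumD f g : fbounded f -> fbounded g ->
  wsum (fun b => f b + g b) = wsum f + wsum g.
Proof.
move=> /split_nneg[f1 [f2 [f10 f20 bf1 bf2 ->]]].
move=> /split_nneg[g1 [g2 [g10 g20 bg1 bg2 ->]]].
rewrite !wsumB_nneg//.
transitivity (wsum (fun b => (f1 b + g1 b) - (f2 b + g2 b))).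
  by congr wsum; apply/funext => b; ring.
rewrite wsumB_nneg ?wsum_nnegD//; first by ring.
- by move=> b; rewrite addr_ge0.
- by move=> b; rewrite addr_ge0.
- exact: fboundedD.
- exact: fboundedD.
Qed.

Lemma wsum0 : wsum (fun=> 0) = 0.
Proof.
rewrite wsum_nneg//; last exact: fbounded_cst.
by rewrite esum1// => b _; rewrite mul0r.
Qed.

Lemma wsumN f : fbounded f -> wsum (fun b => - f b) = - wsum f.
Proof.
move=> bf; apply/eqP; rewrite -subr_eq0 opprK addrC -wsumD//; last exact: fboundedN.
by rewrite -[X in _ == X]wsum0; apply/eqP; congr wsum; apply/funext => b; rewrite subrr.
Qed.

Lemma wsumB f g : fbounded f -> fbounded g ->
  wsum (fun b => f b - g b) = wsum f - wsum g.
Proof. by move=> bf bg; rewrite wsumD ?wsumN//; exact: fboundedN. Qed.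

Lemma wsum_ge0 f : nneg f -> fbounded f -> 0 <= wsum f.
Proof.
move=> f0 bf; rewrite wsum_nneg// fine_ge0// esum_ge0// => b /w_ge0 wb.
by rewrite lee_fin mulr_ge0.
Qed.

Lemma le_wsum f g : fbounded f -> fbounded g -> (forall b, f b <= g b) ->
  wsum f <= wsum g.
Proof.
move=> bf bg fg; rewrite -subr_ge0 -wsumB//.
by apply: wsum_ge0; [move=> b; rewrite subr_ge0 | exact: fboundedB].
Qed.

Lemma ler_norm_wsum f g : fbounded f -> fbounded g ->
  (forall b, `|f b| <= g b) -> `|wsum f| <= wsum g.
Proof.
move=> bf bg fg; rewrite ler_norml -wsumN//; apply/andP; split; apply: le_wsum => //.
- exact: fboundedN.
- by move=> b; have := fg b; rewrite ler_norml => /andP[].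
- by move=> b; have := fg b; rewrite ler_norml => /andP[].
Qed.

Let wsumZ_le (c : R) f : 0 <= c -> nneg f -> fbounded f ->
  wsum (fun b => c * f b) <= c * wsum f.
Proof.
move=> c0 f0 bf.
have bcf : fbounded (fun b => c * f b) by apply: fboundedM => //; exact: fbounded_cst.
have ncf : nneg (fun b => c * f b) by move=> b; rewrite mulr_ge0.
rewrite !wsum_nneg// -lee_fin EFinM !fineK ?esum_wsum_fin//.
apply: ge_ereal_sup => _ [X [finX XD] <-].
under eq_fsbigr do rewrite -mulrA.
rewrite fsumEFin// -mulr_fsumr EFinM -fsumEFin//.
rewrite lee_wpmul2l ?lee_fin//.
by apply: ereal_sup_ubound; exists X.
Qed.

Let wsumZ_nneg (c : R) f : 0 <= c -> nneg f -> fbounded f ->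
  wsum (fun b => c * f b) = c * wsum f.
Proof.
rewrite le_eqVlt => /predU1P[<- _ _|c0 f0 bf].
  by rewrite mul0r -[RHS]wsum0; congr wsum; apply/funext => b; rewrite mul0r.
apply/eqP; rewrite eq_le wsumZ_le// ?(ltW c0)//=.
rewrite -ler_pdivlMl//.
(* The reverse inequality is [wsumZ_le] again, for the factor [c^-1] and the function [c * f]. *)
apply: le_trans (wsumZ_le _ _ _).
- by rewrite le_eqVlt; apply/orP; left; apply/eqP; congr wsum; apply/funext => b;
    rewrite mulKf// gt_eqF.
- by rewrite invr_ge0 ltW.
- by move=> b; rewrite mulr_ge0// ltW.
- by apply: fboundedM => //; exact: fbounded_cst.
Qed.

Lemma wsumZ (c : R) f : fbounded f -> wsum (fun b => c * f b) = c * wsum f.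
Proof.
move=> bf; have bcf (e : R) g : fbounded g -> fbounded (fun b => e * g b).
  by apply: fboundedM; exact: fbounded_cst.
wlog c0 : c / 0 <= c => [H|].
  have [|c0] := leP 0 c; first exact: H.
  have := H (- c); rewrite oppr_ge0 => /(_ (ltW c0)) E.
  rewrite -[c]opprK mulNr -E -wsumN; last exact: bcf.
  by congr wsum; apply/funext => b; rewrite opprK mulNr opprK.
have [f1 [f2 [f10 f20 bf1 bf2 ->]]] := split_nneg bf.
rewrite wsumB// mulrBr -!wsumZ_nneg// -wsumB; [|exact: bcf..].
by congr wsum; apply/funext => b; rewrite mulrBr.
Qed.
End weighted_sum.

(** * The discrete operator and its maximum principle *)

Section discrete_operator.
Variables (R : realType) (d : nat) (h : R) (w : 'rV[int]_d -> R).
Hypothesis w_ge0 : forall b, b != 0 -> 0 <= w b.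
Hypothesis w_fin : (\esum_(b in nonzero_lattice d) (w b)%:E < +oo)%E.
Implicit Types (f g : 'rV[R]_d -> R) (x y : 'rV[R]_d).

(** The jump part of the operator, monotone in [f]; what is left is multiplication by
    [- total_rate]. All positivity arguments rest on this splitting. *)
Definition neighbor_sum f x : R :=
  wsum w (fun b => f (x + lattice_pt h b) + f (x - lattice_pt h b)).

Definition total_rate : R := wsum w (fun=> 2).

Lemma total_rate_ge0 : 0 <= total_rate.
Proof. by apply: wsum_ge0 => //; exact: fbounded_cst. Qed.

Lemma fbounded_neighbors f x : fbounded f ->
  fbounded (fun b : 'rV[int]_d => f (x + lattice_pt h b) + f (x - lattice_pt h b)).
Proof. by move=> bf; apply: fboundedD; apply: fbounded_comp. Qed.

Lemma discrete_opE f x : fbounded f ->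
  discrete_op h w f x = neighbor_sum f x - total_rate * f x.
Proof.
move=> bf; rewrite mulrC -wsumZ//; last exact: fbounded_cst.
rewrite -wsumB//; last 2 first.
- exact: fbounded_neighbors.
- exact: fbounded_cst.
by congr lattice_sum; apply/funext => b; rewrite [f x * 2]mulrC.
Qed.

Lemma le_neighbor_sum f g x : fbounded f -> fbounded g ->
  (forall y, f y <= g y) -> neighbor_sum f x <= neighbor_sum g x.
Proof.
move=> bf bg fg; apply: le_wsum => //; try exact: fbounded_neighbors.
by move=> b; rewrite lerD.
Qed.

Lemma ler_norm_neighbor_sum f g x : fbounded f -> fbounded g ->
  (forall y, `|f y| <= g y) -> `|neighbor_sum f x| <= neighbor_sum g x.
Proof.
move=> bf bg fg; apply: ler_norm_wsum => //; try exact: fbounded_neighbors.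
by move=> b; apply: le_trans (ler_normD _ _) _; rewrite lerD.
Qed.

Lemma neighbor_sumZ c f x : fbounded f ->
  neighbor_sum (fun y => c * f y) x = c * neighbor_sum f x.
Proof.
move=> bf; rewrite -wsumZ//; last exact: fbounded_neighbors.
by congr wsum; apply/funext => b; rewrite mulrDr.
Qed.

Lemma neighbor_sumB f g x : fbounded f -> fbounded g ->
  neighbor_sum (fun y => f y - g y) x = neighbor_sum f x - neighbor_sum g x.
Proof.
move=> bf bg; rewrite -wsumB//; try exact: fbounded_neighbors.
by congr wsum; apply/funext => b; ring.
Qed.

Lemma neighbor_sum_cst c x : neighbor_sum (fun=> c) x = total_rate * c.
Proof.
rewrite mulrC -wsumZ//; last exact: fbounded_cst.
by congr wsum; apply/funext => b; ring.
Qed.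

Lemma ler_norm_neighbor_sum_cst f x S : (forall y, `|f y| <= S) ->
  `|neighbor_sum f x| <= total_rate * S.
Proof.
move=> fS; rewrite -(neighbor_sum_cst S x); apply: ler_norm_neighbor_sum => //.
- by exists S.
- exact: fbounded_cst.
Qed.

Lemma discrete_opZ c f x : fbounded f ->
  discrete_op h w (fun y => c * f y) x = c * discrete_op h w f x.
Proof.
move=> bf; rewrite !discrete_opE//; last by apply: fboundedM => //; exact: fbounded_cst.
by rewrite neighbor_sumZ//; ring.
Qed.

Lemma discrete_opB f g x : fbounded f -> fbounded g ->
  discrete_op h w (fun y => f y - g y) x =
  discrete_op h w f x - discrete_op h w g x.
Proof.
move=> bf bg; rewrite !discrete_opE//; last exact: fboundedB.
by rewrite neighbor_sumB//; ring.
Qed.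

Lemma discrete_op0 x : discrete_op h w (fun=> 0) x = 0.
Proof.
rewrite discrete_opE; last exact: fbounded_cst.
by rewrite neighbor_sum_cst subrr.
Qed.

Lemma discrete_opD f g x : fbounded f -> fbounded g ->
  discrete_op h w (fun y => f y + g y) x =
  discrete_op h w f x + discrete_op h w g x.
Proof.
move=> bf bg.
have bN : fbounded (fun y => -1 * g y) by apply: fboundedM => //; exact: fbounded_cst.
have -> : (fun y => f y + g y) = (fun y => f y - (-1 * g y)).
  by apply/funext => y; rewrite mulN1r opprK.
by rewrite discrete_opB// discrete_opZ// mulN1r opprK.
Qed.

Lemma discrete_op_sum (I : eqType) (r : seq I) (F : I -> 'rV[R]_d -> R) x :
  (forall i, i \in r -> fbounded (F i)) ->
  discrete_op h w (fun y => \sum_(i <- r) F i y) x =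
  \sum_(i <- r) discrete_op h w (F i) x.
Proof.
elim: r => [|i r IH] bF.
  rewrite big_nil -[RHS](discrete_op0 x).
  suff -> : (fun y => \sum_(i <- [::]) F i y) = fun=> 0 by [].
  by apply/funext => y; rewrite big_nil.
rewrite big_cons -IH; last by move=> j jr; apply: bF; rewrite inE jr orbT.
rewrite -discrete_opD.
- suff -> : (fun y => \sum_(j <- i :: r) F j y) =
            (fun y => F i y + \sum_(j <- r) F j y) by [].
  by apply/funext => y; rewrite big_cons.
- by apply: bF; rewrite inE eqxx.
- rewrite (_ : (fun y => _) = fun y => \sum_(j <- r | j \in r) F j y); last first.
    by apply/funext => y; rewrite big_seq.
  by apply: fbounded_sum => j jr; apply: bF; rewrite inE jr orbT.
Qed.

Lemma discrete_op_shift f x y :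
  discrete_op h w (fun z => f (z + y)) x = discrete_op h w f (x + y).
Proof.
have E p : x + p + y = x + y + p by rewrite addrAC.
rewrite /discrete_op; suff -> : (fun b : 'rV[int]_d =>
    (f (x + lattice_pt h b + y) + f (x - lattice_pt h b + y) - 2 * f (x + y)) * w b) =
  fun b => (f (x + y + lattice_pt h b) + f (x + y - lattice_pt h b) - 2 * f (x + y)) * w b by [].
by apply/funext => b; rewrite !E.
Qed.

Lemma fbounded_discrete_op f : fbounded f -> fbounded (discrete_op h w f).
Proof.
move=> /[dup] bf [M fM]; exists (total_rate * M + total_rate * M) => x.
rewrite discrete_opE//; apply: le_trans (ler_normB _ _) _.
rewrite lerD ?ler_norm_neighbor_sum_cst// normrM ger0_norm ?total_rate_ge0//.
by rewrite ler_wpM2l ?total_rate_ge0.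
Qed.

(** Adding [K * f] turns the diagonal coefficient into [K - total_rate * D >= 0]. All coefficients
    are then nonnegative with total mass [K], and no maximum point of [f] is required. *)
Lemma diffusion_norm_le (D : R) K f x S : 0 <= D -> total_rate * D <= K ->
  (forall y, `|f y| <= S) -> `|D * discrete_op h w f x + K * f x| <= K * S.
Proof.
move=> D0 DK fS; rewrite discrete_opE; last by exists S.
have -> : D * (neighbor_sum f x - total_rate * f x) + K * f x =
  D * neighbor_sum f x + (K - total_rate * D) * f x by ring.
apply: le_trans (ler_normD _ _) _; rewrite !normrM.
rewrite (ger0_norm D0) [`|K - _|]ger0_norm ?subr_ge0//.
apply: (@le_trans _ _ (D * (total_rate * S) + (K - total_rate * D) * S)).
  by rewrite lerD// ler_wpM2l ?subr_ge0// ler_norm_neighbor_sum_cst.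
by rewrite le_eqVlt; apply/orP; left; apply/eqP; ring.
Qed.

(* At a maximum of f the jump terms weighted by D (x +/- h b) >= 0 are nonpositive,
   which leaves only the zero-order term [discrete_op D x * f x]. *)
Lemma dual_diffusion_norm_le (D : 'rV[R]_d -> R) K C f x S :
  fbounded D -> (forall y, 0 <= D y) -> total_rate * D x <= K ->
  `|discrete_op h w D x| <= C ->
  (forall y, `|f y| <= S) ->
  `|discrete_op h w (fun y => D y * f y) x + K * f x| <= (K + C) * S.
Proof.
move=> bD D0 DK LD fS; have bf : fbounded f by exists S.
have S0 : 0 <= S by apply: le_trans (fS 0).
rewrite discrete_opE; last exact: fboundedM.
have -> : neighbor_sum (fun y => D y * f y) x - total_rate * (D x * f x) + K * f x =
  neighbor_sum (fun y => D y * f y) x + (K - total_rate * D x) * f x by ring.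
apply: le_trans (ler_normD _ _) _.
apply: (@le_trans _ _ (S * neighbor_sum D x + (K - total_rate * D x) * S)).
  apply: lerD.
    rewrite -neighbor_sumZ//; apply: ler_norm_neighbor_sum.
    - exact: fboundedM.
    - by apply: fboundedM => //; exact: fbounded_cst.
    - by move=> y; rewrite normrM ger0_norm// mulrC ler_wpM2r.
  by rewrite normrM [`|K - _|]ger0_norm ?subr_ge0// ler_wpM2l ?subr_ge0.
have : discrete_op h w D x <= C by exact: le_trans (ler_norm _) LD.
rewrite discrete_opE// => {}LD.
have -> : S * neighbor_sum D x + (K - total_rate * D x) * S =
  (K + (neighbor_sum D x - total_rate * D x)) * S by ring.
by rewrite ler_wpM2r// lerD2l.
Qed.

(** Applied with [g y] the minimum of |y|^r and 1, against which the weights are bounded uniformly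
    in h < 1; unlike a bound through [total_rate], this one survives h -> 0. *)
Lemma discrete_op_le f (g : 'rV[R]_d -> R) K C x : fbounded f -> 0 <= K ->
  (forall y, 0 <= g y <= 1) ->
  (\esum_(b in nonzero_lattice d) (g (lattice_pt h b) * w b)%:E <= C%:E)%E ->
  (forall y, `|f (x + y) + f (x - y) - 2 * f x| <= K * g y) ->
  `|discrete_op h w f x| <= K * C.
Proof.
move=> bf K0 g01 gC fg.
have g0 y : 0 <= g y by have /andP[] := g01 y.
have bg : fbounded (fun b => g (lattice_pt h b)).
  by exists 1 => b; have /andP[? ?] := g01 (lattice_pt h b); rewrite ger0_norm.
apply: (@le_trans _ _ (wsum w (fun b => K * g (lattice_pt h b)))).
  apply: (ler_norm_wsum w_ge0 w_fin) => //.
  - by apply: fboundedB; [exact: fbounded_neighbors | exact: fbounded_cst].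
  - by apply: fboundedM => //; exact: fbounded_cst.
rewrite (wsumZ w_ge0 w_fin)// ler_wpM2l// -lee_fin (wsum_nneg w_ge0 w_fin)// fineK//.
exact: esum_wsum_fin.
Qed.

End discrete_operator.

(** * The L1 discretization of the Caputo derivative *)

Section gamma.
Variable R : realType.
Notation mu := (@lebesgue_measure R).

(** [Gamma] is the [fine] of an extended integral and [fine +oo] is 0, so positivity includes
    finiteness. The integrand is at least e^-2 on [1, 2]. From above, x^(z-1) <= 1 + x <= 2 e^(x/2)
    bounds it by 4 times the exponential density of rate 1/2, whose integral is 1. *)
Lemma Gamma_gt0 (z : R) : 1 <= z <= 2 -> 0 < Gamma z.
Proof.
move=> /andP[z1 z2]; rewrite /Gamma /Rintegral.
set f := fun x : R => x `^ (z - 1) * expR (- x).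
have mf : measurable_fun setT (EFin \o f).
  apply/measurable_EFinP.
  apply: measurable_funM => //.
  by apply: measurableT_comp => //; apply: measurableT_comp.
have f0 x : (0 <= (f x)%:E)%E by rewrite lee_fin mulr_ge0 ?powR_ge0 ?expR_ge0.
have fle x : 0 <= x -> f x <= 4 * exponential_pdf 2^-1 x.
  move=> x0; rewrite exponential_pdfE// /f.
  have powle : x `^ (z - 1) <= 1 + x.
    have [x1|x1] := leP x 1.
      have [->|xn0] := eqVneq x 0.
        have [->|zn] := eqVneq (z - 1) 0; first by rewrite powRr0 addr0.
        by rewrite powR0// addr0.
      apply: (@le_trans _ _ 1); last by rewrite lerDl.
      rewrite -[leRHS](powRr0 x); apply: ger_powR; last by rewrite subr_ge0.
      by rewrite lt0r xn0 x0 x1.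
    apply: (@le_trans _ _ x); last by rewrite lerDr.
    by apply: ler1_powR; [exact: ltW | lra].
  have e1 := expR_ge1Dx (x / 2).
  have -> : 4 * (2^-1 * expR (- 2^-1 * x)) = 2 * expR (x / 2) * expR (- x).
    rewrite -mulrA -expRD (_ : x / 2 + - x = - 2^-1 * x); last by field.
    by rewrite mulrA (_ : 4 * 2^-1 = 2 :> R)//; field.
  by rewrite ler_wpM2r ?expR_ge0//; apply: le_trans powle _; lra.
rewrite fine_gt0//; apply/andP; split.
  apply: (@lt_le_trans _ _ (\int[mu]_(x in `[1%R, 2%R]) (expR (- 2))%:E)%E).
    rewrite integral_cst//= lebesgue_measure_itv/= lte_fin ltr1n.
    by rewrite mule_gt0// lte_fin ?expR_gt0// subr_gt0 ltr1n.
  apply: (@le_trans _ _ (\int[mu]_(x in `[1%R, 2%R]) (f x)%:E)%E).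
    apply: ge0_le_integral => //=.
    - exact: (measurable_funTS mf).
    - move=> x; rewrite /= in_itv/= => /andP[x1 x2].
      rewrite lee_fin -[leLHS]mul1r ler_pM ?expR_ge0//; last by rewrite ler_expR lerN2.
      by rewrite -[leLHS](powRr0 x) ler_powR// subr_ge0.
  apply: ge0_subset_integral => //; first exact: (measurable_funTS mf).
  by move=> x; rewrite /= !in_itv/= andbT => /andP[x1 _]; lra.
apply: (@le_lt_trans _ _ (\int[mu]_(x in `]0%R, +oo[) (4 * exponential_pdf 2^-1 x)%:E)%E).
  apply: ge0_le_integral => //=.
  - by move=> x _; exact: f0.
  - exact: (measurable_funTS mf).
  - apply/measurable_EFinP; apply: measurable_funTS; apply: measurable_funM => //.
    exact: measurable_exponential_pdf.
  - by move=> x; rewrite /= in_itv/= andbT => x0; rewrite lee_fin fle// ltW.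
apply: (@le_lt_trans _ _ (\int[mu]_x (4 * exponential_pdf 2^-1 x)%:E)%E).
  apply: ge0_subset_integral => //.
  - apply/measurable_EFinP; apply: measurable_funM => //.
    exact: measurable_exponential_pdf.
  - by move=> x _; rewrite lee_fin mulr_ge0// exponential_pdf_ge0// invr_ge0.
under eq_integral do rewrite EFinM.
rewrite ge0_integralZl//.
- by rewrite integral_exponential_pdf ?mule1 ?ltry// invr_gt0.
- by apply/measurable_EFinP; exact: measurable_exponential_pdf.
- by move=> x _; rewrite lee_fin exponential_pdf_ge0// invr_ge0.
Qed.

End gamma.

Section L1_coefficients.
Variables (R : realType) (alpha : R).
Hypothesis alpha01 : 0 < alpha < 1.
Notation b := (L1_coef alpha).
Notation phi := (fun x : R => x `^ (1 - alpha)).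

Let within_powR (x y : R) (p : R) : 0 < x ->
  {within `[x, y], continuous (fun z : R => z `^ p)}.
Proof.
move=> x0; apply: derivable_within_continuous => z; rewrite in_itv/= => /andP[xz _].
by apply: derivable_powR; rewrite in_itv/= andbT (lt_le_trans x0).
Qed.

Let powR_MVT (x y p : R) : 0 < x -> x < y ->
  exists2 c, x < c < y & y `^ p - x `^ p = p * c `^ (p - 1) * (y - x).
Proof.
move=> x0 xy; have [] := @MVT _ (fun z => z `^ p) (fun z => p * z `^ (p - 1)) x y xy.
- move=> z; rewrite in_itv/= => /andP[xz _].
  by apply: is_derive1_powR; exact: lt_trans xz.
- exact: within_powR.
- by move=> c; rewrite in_itv/=; exists c.
Qed.

Let a0 : 0 < alpha. Proof. by case/andP: alpha01. Qed.
Let a1 : alpha < 1. Proof. by case/andP: alpha01. Qed.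
Let a1' : 0 < 1 - alpha. Proof. by rewrite subr_gt0. Qed.

Let powRN_le (x y p : R) : 0 < x -> x <= y -> 0 <= p -> y `^ (- p) <= x `^ (- p).
Proof.
move=> x0 xy p0; have y0 : 0 < y by exact: lt_le_trans xy.
rewrite !powRN lef_pV2 ?posrE ?powR_gt0//.
by rewrite ge0_ler_powR// ?nnegrE ltW.
Qed.

Lemma L1_coef0 : b 0 = 1.
Proof. by rewrite /L1_coef powR1 powR0 ?subr0// gt_eqF. Qed.

Lemma L1_coef_ge i : (1 - alpha) * i.+1%:R `^ (- alpha) <= b i.
Proof.
(* The mean value theorem is applied on intervals with positive left end, so index 0 is read off
   from [b 0 = 1]. *)
case: i => [|i]; first by rewrite L1_coef0 powR1 mulr1 gerBl ltW.
have [||c /andP[ic ci]] := @powR_MVT i.+1%:R i.+2%:R (1 - alpha).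
- by rewrite ltr0n.
- by rewrite ltr_nat.
rewrite /L1_coef => ->; rewrite -natrB// subSnn mulr1 ler_pM2l//.
rewrite addrAC subrr add0r; apply: powRN_le; rewrite ?(ltW ci)// ?(ltW a0)//.
by apply: lt_trans ic; rewrite ltr0n.
Qed.

Lemma L1_coef_ge0 i : 0 <= b i.
Proof. by apply: le_trans (L1_coef_ge i); rewrite mulr_ge0 ?powR_ge0// ltW. Qed.

(** The left-hand factor is minus the second derivative of x^(1-alpha) at i + 2: two mean value
    steps produce this derivative at a point below i + 2, where it is larger. The sign alone serves
    the maximum principle; this quantitative form is the lower bound on the memory kernel behind the
    modulus in time. *)
Lemma L1_coef_diff_ge i :
  alpha * (1 - alpha) * i.+2%:R `^ (- (1 + alpha)) <= b i - b i.+1.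
Proof.
have p_le1 (n : nat) p : 0 <= p -> n.+1%:R `^ (- p) <= 1 :> R.
  move=> p0; rewrite -[leRHS](powRr0 n.+1%:R); apply: ler_powR; first by rewrite ler1n.
  by rewrite oppr_le0.
case: i => [|i].
  rewrite L1_coef0 /L1_coef.
  have [||c /andP[ic ci]] := @powR_MVT 1 2 (1 - alpha); rewrite ?ltr1n// => ->.
  have -> : (2 - 1 : R) = 1 by lra.
  rewrite mulr1 addrAC subrr add0r.
  have c1 : c `^ (- alpha) <= 1.
    rewrite -[leRHS](powRr0 c); apply: ler_powR; first exact: ltW.
    by rewrite oppr_le0 ltW.
  apply: (@le_trans _ _ alpha).
    rewrite -mulrA ger_pMr// mulr_ile1 ?powR_ge0//; [exact: ltW| |].
      by rewrite gerBl ltW.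
    by apply: p_le1; rewrite addr_ge0// ltW.
  have : (1 - alpha) * c `^ (- alpha) <= (1 - alpha) * 1 by rewrite ler_wpM2l// ltW.
  by lra.
pose g (x : R) := (x + 1) `^ (1 - alpha) - x `^ (1 - alpha).
pose dg (x : R) := (1 - alpha) * (x + 1) `^ (- alpha) - (1 - alpha) * x `^ (- alpha).
have i0 : (0 : R) < i.+1%:R by rewrite ltr0n.
have gd (x : R) : 0 < x -> is_derive x 1 g (dg x).
  move=> x0; have x10 : 0 < x + 1 by rewrite addr_gt0.
  have e : 1 - alpha - 1 = - alpha by ring.
  have pd (y : R) : 0 < y ->
      is_derive y 1 (fun y : R => y `^ (1 - alpha)) ((1 - alpha) * y `^ (- alpha)).
    by move=> y0; have := is_derive1_powR (1 - alpha) y0; rewrite e.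
  rewrite /g /dg; apply: is_deriveB; last exact: pd.
  have := pd _ x10.
  have s : is_derive x 1 (fun x : R => x + 1) 1.
    by rewrite -[X in is_derive _ _ _ X]addr0; apply: is_deriveD.
  move=> p; have := @is_derive1_comp _ (fun y : R => y `^ (1 - alpha))
    (fun x : R => x + 1) x _ _ p s.
  by rewrite mulr1.
have [|||c] := @MVT _ g dg i.+1%:R i.+2%:R; rewrite ?ltr_nat//.
- move=> x; rewrite in_itv/= => /andP[ix _].
  by apply: gd; apply: lt_trans ix.
- apply: derivable_within_continuous => x; rewrite in_itv/= => /andP[ix _].
  have /gd [] : 0 < x by apply: lt_le_trans ix.
  by [].
rewrite in_itv/= => /andP[ic ci]; rewrite -natrB// subSnn mulr1 => Ec.
have c0 : 0 < c by exact: lt_trans ic.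
have [||e /andP[ce ec] Ee] := @powR_MVT c (c + 1) (- alpha); rewrite ?ltrDl//.
have -> : b i.+1 - b i.+2 = - (g i.+2%:R - g i.+1%:R).
  by rewrite /L1_coef /g -!natr1; ring.
rewrite Ec /dg -mulrBr Ee.
have -> : - ((1 - alpha) * (- alpha * e `^ (- alpha - 1) * (c + 1 - c))) =
  alpha * (1 - alpha) * e `^ (- (1 + alpha)).
  by rewrite (_ : - alpha - 1 = - (1 + alpha)); ring.
rewrite ler_wpM2l ?mulr_ge0 ?(ltW a0) ?(ltW a1')//; apply: powRN_le.
- exact: lt_trans ce.
- apply: le_trans (ltW ec) _; rewrite -natr1 lerD2r; exact: ltW.
- by rewrite addr_ge0// ltW.
Qed.

Definition L1_diff i := b i - b i.+1.

Lemma L1_diff_ge0 i : 0 <= L1_diff i.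
Proof.
apply: le_trans (L1_coef_diff_ge i).
by rewrite !mulr_ge0 ?powR_ge0 ?(ltW a0) ?(ltW a1').
Qed.

Lemma sum_L1_diff m n : (m <= n)%N -> \sum_(m <= j < n) L1_diff j = b m - b n.
Proof.
move=> mn; rewrite -opprB -telescope_sumr// -sumrN.
by apply: eq_bigr => j _; rewrite opprB.
Qed.

(* With v extended by the constant v 0 to negative times (truncated subtraction
   does this), the L1 derivative is an average of backward differences over any
   window K containing the whole history. *)
Lemma caputo_L1E (tau : R) (v : nat -> R) n K : (n <= K)%N ->
  caputo_L1 alpha tau v n.+1 = tau `^ (- alpha) / Gamma (2 - alpha) *
    (v n.+1 - (\sum_(0 <= j < K) L1_diff j * v (n - j)%N + b K * v 0%N)).
Proof.
move=> nK.
have -> : \sum_(0 <= j < K) L1_diff j * v (n - j)%N =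
    \sum_(0 <= j < n) L1_diff j * v (n - j)%N + (b n - b K) * v 0%N.
  rewrite (@big_cat_nat _ _ _ n)//=; congr (_ + _).
  rewrite -sum_L1_diff// mulr_suml; apply: eq_big_nat => j /andP[nj _].
  by congr (_ * v _); apply/eqP; rewrite subn_eq0.
rewrite /caputo_L1 subn1/=.
have -> : \sum_(1 <= k < n.+1) (b (n.+1 - k - 1) - b (n.+1 - k)) * v k =
    \sum_(0 <= j < n) L1_diff j * v (n - j)%N.
  rewrite big_add1/= big_nat_rev/=; apply: eq_big_nat => j /andP[_ jn].
  rewrite /L1_diff add0n.
  have -> : (n - j.+1).+1 = (n - j)%N by lia.
  have -> : (n.+1 - (n - j))%N = j.+1 by lia.
  by rewrite subn1.
by congr (_ * _); ring.
Qed.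

End L1_coefficients.

(** * Discrete fractional Gronwall inequality *)

Lemma window_index_le J n N : (0 < J)%N -> (n <= N)%N ->
  ((n + J.-1) %/ J <= (N %/ J).+1)%N.
Proof.
move=> J0 nN; apply: (@leq_trans ((N + J) %/ J)); last by rewrite divnDr// divnn J0 addn1.
by apply: leq_div2r; lia.
Qed.

(** The quotient [(n + J.-1) %/ J] is the ceiling of n / J: it numbers windows of [J] steps, with n
    = 0 alone in window 0. A lag of at least [J] always leaves the window of [k.+1]; for j > k the
    truncated difference lands in window 0. *)
Lemma window_index_prev J k j : (0 < J)%N -> (J <= j)%N ->
  (((k - j) + J.-1) %/ J < (k.+1 + J.-1) %/ J)%N.
Proof.
move=> J0 Jj; have -> : (k.+1 + J.-1 = k + J)%N by lia.
rewrite [X in (_ < X)%N]divnDr// divnn J0 addn1 ltnS.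
have [kj|jk] := leqP k j; last by apply: leq_div2r; lia.
have -> : (k - j = 0)%N by lia.
by rewrite divn_small//; lia.
Qed.

Section fractional_gronwall.
Variables (R : realType) (alpha : R).
Hypothesis alpha01 : 0 < alpha < 1.
Notation b := (L1_coef alpha).
Notation cst tau := (tau `^ (- alpha) / Gamma (2 - alpha)).

Let a0 : 0 < alpha. Proof. by case/andP: alpha01. Qed.
Let a1 : alpha < 1. Proof. by case/andP: alpha01. Qed.
Let a1' : 0 < 1 - alpha. Proof. by rewrite subr_gt0. Qed.

Let Gamma_pos : 0 < Gamma (2 - alpha).
Proof. by apply: Gamma_gt0; have := a0; have := a1; lra. Qed.

Lemma L1_rate_gt0 (tau : R) : 0 < tau -> 0 < cst tau.
Proof. by move=> t0; rewrite divr_gt0// powR_gt0. Qed.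

(** The product equals ((J + 1) tau)^(-alpha) / Gamma(2 - alpha), a function of the elapsed time
    alone, hence large on short windows whatever tau is. The threshold solves theta^(-alpha) =
    Gamma(2 - alpha) B. *)
Lemma L1_rate_window (B : R) : 0 < B -> exists2 theta, 0 < theta &
  forall tau J, 0 < tau -> J.+1%:R * tau <= theta ->
    B <= cst tau * J.+1%:R `^ (- alpha).
Proof.
move=> B0; pose k := (Gamma (2 - alpha) * B)^-1.
have k0 : 0 < k by rewrite invr_gt0 mulr_gt0.
exists (k `^ alpha^-1); first exact: powR_gt0.
move=> tau J t0 le_theta; have J0 : (0 : R) < J.+1%:R by rewrite ltr0n.
have -> : cst tau * J.+1%:R `^ (- alpha) =
    (J.+1%:R * tau) `^ (- alpha) / Gamma (2 - alpha).
  by rewrite powRM ?ltW//; ring.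
rewrite ler_pdivlMr// mulrC powRN -[leLHS]invrK lef_pV2 ?posrE ?invr_gt0 ?powR_gt0 ?mulr_gt0//.
rewrite -/k; apply: le_trans (_ : (k `^ alpha^-1) `^ alpha <= _).
  by rewrite ge0_ler_powR// ?nnegrE ?ltW// ?mulr_gt0// powR_gt0.
by rewrite -powRrM mulVf ?gt_eqF// powRr1// ltW.
Qed.

Lemma window_size (theta tau : R) : 0 < tau -> tau <= theta / 4 ->
  exists J, [/\ (0 < J)%N, J.+1%:R * tau <= theta & theta <= 2 * J%:R * tau].
Proof.
move=> t0 tt; have th0 : 0 <= theta / tau by rewrite divr_ge0// ?ltW//; lra.
have t4 : 4 <= theta / tau by rewrite ler_pdivlMr//; lra.
(* One step fewer than fit into [theta], to leave room for [J.+1]; at least 4 steps fit, so [J >= 3]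
   and half of [theta] is still covered. *)
exists (Num.truncn (theta / tau)).-1.
have /andP[] := truncn_itv th0.
have : (4 <= Num.truncn (theta / tau))%N by rewrite truncn_ge_nat.
case: (Num.truncn _) => // n n4.
rewrite ler_pdivlMr// ltr_pdivrMr// => h1 h2; split => //=.
  exact: (@leq_trans 3).
have n3 : (3 : R) <= n%:R by rewrite ler_nat.
move: h1 h2; rewrite -!natr1 => h1 h2.
have : 3 * tau <= n%:R * tau by rewrite ler_wpM2r// ltW.
by lra.
Qed.

(* The bound doubles over each time window of fixed length theta: within a window
   the memory term carries a fixed fraction [b J] of its weight on earlier
   windows, and this fraction beats the zero-order growth [C0]. *)
Lemma caputo_gronwall (T C0 : R) : 0 <= C0 ->
  exists E tau0, [/\ 0 <= E, 0 < tau0 &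
  forall (X : Type) (tau : R) N (W : nat -> X -> R) K G S0,
    0 < tau <= tau0 -> N%:R * tau <= T -> 0 <= K -> 0 <= G ->
    (forall n, (n <= N)%N -> fbounded (W n)) ->
    (forall x, `|W 0%N x| <= S0) ->
    (forall n S x, (n < N)%N -> (forall y, `|W n.+1 y| <= S) ->
       `|caputo_L1 alpha tau (W^~ x) n.+1 + K * W n.+1 x| <= (K + C0) * S + G) ->
    forall n x, (n <= N)%N -> `|W n x| <= E * (S0 + G)].
Proof.
move=> C00.
(* With b_J >= (1 - alpha) (J + 1)^(-alpha), this threshold gives [c * b J >= 2 * (C0 + 1)]; the 2
   pays for the halved bound on earlier windows, the 1 for the source [G]. *)
have B0 : 0 < 2 * (C0 + 1) / (1 - alpha) by rewrite divr_gt0//; lra.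
have [theta theta0 Htheta] := L1_rate_window B0.
(* One doubling per window: since [theta <= 2 * J * tau], at most 2 T / theta full windows fit into
   [0, T]. *)
exists (2 ^+ (Num.truncn (2 * T / theta)).+1), (theta / 4).
split=> [||X tau N W K G S0 /andP[t0 tt] NT K0 G0 bW W0 HW n x nN].
- by rewrite exprn_ge0.
- by rewrite divr_gt0.
have [J [J0 Jth thJ]] := window_size t0 tt.
have T0 : 0 <= T by apply: le_trans NT; rewrite mulr_ge0// ltW.
have S00 : 0 <= S0 by apply: le_trans (W0 x).
set c := cst tau; have c0 : 0 < c by exact: L1_rate_gt0.
have cbJ : 2 * (C0 + 1) <= c * b J.
  have := Htheta _ _ t0 Jth; rewrite -/c ler_pdivrMr// => /le_trans; apply.
  by rewrite -mulrA ler_pM2l// mulrC L1_coef_ge.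
pose q n := ((n + J.-1) %/ J)%N.
pose Q n : R := 2 ^+ q n.
pose P := S0 + G.
have P0 : 0 <= P by rewrite addr_ge0.
(* Carrying [G] inside the induction hypothesis makes earlier values smaller by [G] than the
   doubling bound; multiplied by the large [c], this slack absorbs the source. *)
suff main k : (k <= N)%N -> forall x, `|W k x| + G <= Q k * P.
  have := main n nN x; set w := `|_| => H.
  apply: (@le_trans _ _ (Q n * P)); first by apply: le_trans H; rewrite lerDl.
  rewrite ler_wpM2r// /Q ler_weXn2l// ?ler1n//.
  apply: (leq_trans (window_index_le J0 nN)).
  rewrite ltnS truncn_ge_nat; last by rewrite divr_ge0// ?mulr_ge0// ltW.
  rewrite ler_pdivlMr//.
  have h1 : (N %/ J)%:R * theta <= (N %/ J)%:R * (2 * J%:R * tau) by rewrite ler_wpM2l.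
  have h2 : (N %/ J)%:R * J%:R <= N%:R :> R by rewrite -natrM ler_nat leq_trunc_div.
  have h3 : (N %/ J)%:R * J%:R * tau <= N%:R * tau by rewrite ler_wpM2r// ltW.
  by lra.
elim/ltn_ind: k => -[_ _ y|k IH kN y].
  by rewrite /Q /q divn_small ?expr0 ?mul1r ?lerD2r// add0n prednK.
have Qle i : (i <= k)%N -> Q i <= Q k.+1.
  move=> ik; rewrite /Q ler_eXn2l ?ltr1n//.
  by rewrite leq_div2r// leq_add2r leqW.
have Qle2 j : (J <= j)%N -> 2 * Q (k - j)%N <= Q k.+1.
  by move=> Jj; rewrite /Q -exprS ler_eXn2l ?ltr1n// window_index_prev.
have [Mw Mw0 HMw] := fbounded_ge0 (bW _ kN).
pose A := [set `|W k.+1 z| | z in [set: X]].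
have supA : has_sup A.
  by split; [exists (`|W k.+1 y|); exists y | exists Mw => _ [z _ <-]].
pose S := sup A.
have WS z : `|W k.+1 z| <= S by apply: sup_upper_bound => //; exists z.
have S0' : 0 <= S by apply: le_trans (WS y).
pose QP := Q k.+1 * P.
have bJ0 : 0 <= b J by exact: L1_coef_ge0.
(* Lags below [J] have total weight [1 - b J] and obey the bound of the current window. Older lags
   together with the initial value have weight [b J] and obey half of it. *)
have memory z : `|\sum_(0 <= j < k + J) L1_diff alpha j * W (k - j)%N z
    + b (k + J) * W 0%N z| <= QP - G - b J * (QP / 2).
  have tail1 : `|\sum_(0 <= j < J) L1_diff alpha j * W (k - j)%N z|
      <= (1 - b J) * (QP - G).
    rewrite -(L1_coef0 alpha01) -sum_L1_diff// mulr_suml.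
    apply: le_trans (ler_norm_sum _ _ _) _; apply: ler_sum => j _.
    rewrite normrM ger0_norm ?L1_diff_ge0// ler_wpM2l ?L1_diff_ge0//.
    have := IH (k - j)%N; rewrite ltnS leq_subr => /(_ isT).
    move=> /(_ (leq_trans (leq_subr _ _) (ltnW kN)) z).
    have := Qle (k - j)%N (leq_subr _ _).
    move=> /(ler_wpM2r P0); rewrite -/QP.
    by lra.
  have old j : (J <= j)%N -> `|W (k - j)%N z| <= QP / 2 - G.
    move=> Jj; have := IH (k - j)%N; rewrite ltnS leq_subr => /(_ isT).
    move=> /(_ (leq_trans (leq_subr _ _) (ltnW kN)) z).
    have := Qle2 _ Jj => /(ler_wpM2r P0); rewrite -/QP.
    by lra.
  have tail2 : `|\sum_(J <= j < k + J) L1_diff alpha j * W (k - j)%N z|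
      <= (b J - b (k + J)) * (QP / 2 - G).
    rewrite -sum_L1_diff ?leq_addl// mulr_suml.
    apply: le_trans (ler_norm_sum _ _ _) _; apply: ler_sum_nat => j /andP[Jj _].
    by rewrite normrM ger0_norm ?L1_diff_ge0// ler_wpM2l ?L1_diff_ge0// old.
  have tail3 : `|b (k + J) * W 0%N z| <= b (k + J) * (QP / 2 - G).
    rewrite normrM ger0_norm ?L1_coef_ge0// ler_wpM2l ?L1_coef_ge0//.
    have := old (k + J)%N (leq_addl _ _).
    by have /eqP -> : (k - (k + J) == 0)%N by rewrite subn_eq0 leq_addr.
  rewrite (@big_cat_nat _ _ _ J)//= ?leq_addl//.
  apply: le_trans (ler_normD _ _) _.
  apply: le_trans (lerD (ler_normD _ _) (lexx _)) _.
  by lra.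
have key z : (c + K) * `|W k.+1 z| <= c * (QP - G - b J * (QP / 2)) + ((K + C0) * S + G).
  have := HW k S z kN WS.
  rewrite (caputo_L1E alpha01 _ _ (leq_addr J k)) -/c.
  move: (memory z); set m := \sum_(0 <= j < _) _ + _ => Hm Hz.
  have -> : (c + K) * `|W k.+1 z| =
      `|c * m + (c * (W k.+1 z - m) + K * W k.+1 z)|.
    rewrite (_ : c * m + _ = (c + K) * W k.+1 z); last by ring.
    by rewrite normrM [`|c + K|]ger0_norm// addr_ge0// ltW.
  apply: le_trans (ler_normD _ _) _; rewrite lerD//.
  by rewrite normrM (ger0_norm (ltW c0)) ler_wpM2l// ltW.
have cK : 0 < c + K by rewrite ltr_wpDr.
(* Passing to the supremum on the left makes [K * S] cancel, so the result is independent of [K]. *)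
have : (c + K) * S <= c * (QP - G - b J * (QP / 2)) + ((K + C0) * S + G).
  rewrite mulrC -ler_pdivlMr//; apply: ge_sup; first by exists (`|W k.+1 y|); exists y.
  by move=> _ [z1 _ <-]; rewrite ler_pdivlMr// mulrC; exact: key.
move=> HS.
have bJ1 : b J <= 1.
  have := sum_L1_diff alpha (leq0n J); rewrite (L1_coef0 alpha01) => E1.
  by rewrite -subr_ge0 -E1 sumr_ge0// => j _; exact: L1_diff_ge0.
have QP0 : 0 <= QP by rewrite mulr_ge0// exprn_ge0.
have cC1 : 2 * (C0 + 1) <= c.
  by apply: le_trans cbJ _; rewrite ger_pMr.
apply: le_trans (_ : S + G <= _); first by rewrite lerD2r.
have cC2 : 0 < c - (C0 + 1) by lra.
rewrite -(ler_pM2l cC2) -/QP.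
have h1 : c * (b J * (QP / 2)) >= (C0 + 1) * QP.
  have : 2 * (C0 + 1) * (QP / 2) <= c * b J * (QP / 2) by rewrite ler_wpM2r// divr_ge0.
  by lra.
have h2 : 0 <= C0 * G by rewrite mulr_ge0.
rewrite -subr_ge0; move: HS; rewrite -subr_ge0.
set u := (X in 0 <= X -> _) => Hu.
have -> : (c - (C0 + 1)) * QP - (c - (C0 + 1)) * (S + G) =
  u + (c * (b J * (QP / 2)) - (C0 + 1) * QP) + S + C0 * G by rewrite /u; field.
by rewrite addr_ge0// addr_ge0// addr_ge0// subr_ge0.
Qed.

End fractional_gronwall.

(** * Modulus of continuity in time *)

Section time_modulus.
Variables (R : realType) (alpha : R).
Hypothesis alpha01 : 0 < alpha < 1.
Notation b := (L1_coef alpha).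
Notation cst tau := (tau `^ (- alpha) / Gamma (2 - alpha)).

Let a0 : 0 < alpha. Proof. by case/andP: alpha01. Qed.
Let a1' : 0 < 1 - alpha. Proof. by case/andP: alpha01 => _; rewrite subr_gt0. Qed.

(** The two sums are shifts of each other by [l], so only [l] terms survive at each end and the
    bound does not grow with [J]. *)
Lemma sum_lag_le (v : nat -> R) M n l J : (forall k, (k <= n)%N -> `|v k| <= M) ->
  \sum_(0 <= j < J) (v (n - j.+1)%N - v (n - l - j.+1)%N) <= 2 * M * l%:R.
Proof.
move=> vM; pose w j := v (n - j.+1)%N.
have wM j : `|w j| <= M by apply: vM; exact: leq_subr.
have -> : \sum_(0 <= j < J) (v (n - j.+1)%N - v (n - l - j.+1)%N) =
    \sum_(0 <= j < l) w j - \sum_(0 <= j < l) w (j + J)%N.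
  have shift p q : \sum_(0 <= j < p + q) w j =
      \sum_(0 <= j < p) w j + \sum_(0 <= j < q) w (j + p)%N.
    rewrite (@big_cat_nat _ _ _ p)//= ?leq_addr//; congr (_ + _).
    by rewrite -{1}[p]add0n big_addn addKn.
  have : \sum_(0 <= j < J) w j + \sum_(0 <= j < l) w (j + J)%N =
      \sum_(0 <= j < l) w j + \sum_(0 <= j < J) w (j + l)%N.
    by rewrite -!shift addnC.
  have -> : \sum_(0 <= j < J) (v (n - j.+1)%N - v (n - l - j.+1)%N) =
      \sum_(0 <= j < J) w j - \sum_(0 <= j < J) w (j + l)%N.
    rewrite -sumrB; apply: eq_bigr => j _; congr (_ - v _).
    by rewrite -subnDA addnC addSn.
  by lra.
rewrite -sumrB; apply: (@le_trans _ _ (\sum_(0 <= j < l) (2 * M))).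
  apply: ler_sum => j _; have := wM j; have := wM (j + J)%N.
  by rewrite !ler_norml => /andP[? ?] /andP[? ?]; lra.
by rewrite sumr_const_nat subn0 mulr_natr.
Qed.

(* At the maximal lagged difference S the derivative bound controls the average
   of S - z over a window, while the sum of z over the window telescopes. *)
Lemma lag_le (tau : R) (v : nat -> R) M A N J l n : 0 < tau -> (0 < J)%N ->
  (forall k, (k <= N)%N -> `|v k| <= M) ->
  (forall k, (k < N)%N -> `|caputo_L1 alpha tau v k.+1| <= A) -> 0 <= A ->
  (n <= N)%N ->
  (v n - v (n - l)%N) * J%:R <=
    2 * M * l%:R + 2 * A / (cst tau * (alpha * (1 - alpha) * J.+1%:R `^ (- (1 + alpha)))).
Proof.
move=> t0 J0 vM vA A0 nN.
set c := cst tau; set kap := alpha * _ * _.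
have c0 : 0 < c by exact: L1_rate_gt0.
have kap0 : 0 < kap by rewrite !mulr_gt0// powR_gt0.
pose z k := v k - v (k - l)%N.
have [p _ pmax] : exists2 p : 'I_N.+1, true & forall k : 'I_N.+1, z k <= z p.
  exists [arg max_(i > (ord0 : 'I_N.+1)) z i]%O => //.
  by case: arg_maxP => // i _ H k; exact: H.
have zmax k : (k <= N)%N -> z k <= z p.
  by move=> kN; have := pmax (Ordinal (kN : (k < N.+1)%N)).
have pN : (p <= N)%N by rewrite -ltnS.
suff : z p * J%:R <= 2 * M * l%:R + 2 * A / (c * kap).
  by apply: le_trans; rewrite ler_wpM2r// zmax.
have zp0 : 0 <= z p by have := zmax 0%N isT; rewrite /z sub0n subrr.
(* The L1 derivative written over one window common to all [q]. Truncated subtraction also gives it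
   a meaning at [q = 0], where it vanishes; this matters because [p - l] may be 0. *)
pose H q := c * (v q - (\sum_(0 <= j < N + J) L1_diff alpha j * v (q - j.+1)%N
  + b (N + J) * v 0%N)).
have HA q : (q <= N)%N -> `|H q| <= A.
  case: q => [_|q qN].
    rewrite /H; under eq_bigr do rewrite sub0n.
    rewrite -mulr_suml sum_L1_diff// L1_coef0//.
    by rewrite (_ : c * _ = 0) ?normr0//; ring.
  have qNJ : (q <= N + J)%N by rewrite (leq_trans (ltnW qN))// leq_addr.
  have := vA q qN; rewrite (caputo_L1E alpha01 _ _ qNJ) -/c.
  by rewrite /H; under [X in _ -> `|_ * (_ - (X + _))| <= _]eq_bigr do rewrite subSS.
have plN : (p - l <= N)%N by rewrite (leq_trans (leq_subr _ _)).
have HH : H p - H (p - l)%N <= 2 * A.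
  have := HA _ pN; have := HA _ plN.
  by rewrite !ler_norml => /andP[? ?] /andP[? ?]; lra.
have : c * (kap * (z p * J%:R - 2 * M * l%:R)) <= H p - H (p - l)%N.
  have -> : H p - H (p - l)%N = c * (b (N + J) * z p +
      \sum_(0 <= j < N + J) L1_diff alpha j * (z p - z (p - j.+1)%N)).
    have -> : \sum_(0 <= j < N + J) L1_diff alpha j * (z p - z (p - j.+1)%N) =
        (1 - b (N + J)) * z p -
        (\sum_(0 <= j < N + J) L1_diff alpha j * v (p - j.+1)%N
        - \sum_(0 <= j < N + J) L1_diff alpha j * v (p - l - j.+1)%N).
      rewrite -(L1_coef0 alpha01) -sum_L1_diff// mulr_suml -!sumrB.
      apply: eq_bigr => j _; rewrite /z [(p - l - _)%N]subnAC; ring.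
    by rewrite /H /z; ring.
  rewrite ler_pM2l//; apply: (@le_trans _ _
      (\sum_(0 <= j < J) L1_diff alpha j * (z p - z (p - j.+1)%N))).
    apply: (@le_trans _ _ (\sum_(0 <= j < J) kap * (z p - z (p - j.+1)%N))).
      rewrite -mulr_sumr ler_pM2l// sumrB sumr_const_nat subn0 -[z p *+ _]mulr_natr lerD2l lerN2.
      rewrite /z; under eq_bigr do rewrite subnAC.
      apply: sum_lag_le => k kp; apply: vM; exact: leq_trans pN.
    apply: ler_sum_nat => j /andP[_ jJ].
    have zz : 0 <= z p - z (p - j.+1)%N.
      by rewrite subr_ge0 zmax// (leq_trans (leq_subr _ _)).
    rewrite ler_wpM2r//; apply: le_trans (L1_coef_diff_ge alpha01 j).
    rewrite ler_wpM2l ?mulr_ge0 ?(ltW a0) ?(ltW a1')// !powRN.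
    rewrite lef_pV2 ?posrE ?powR_gt0 ?ltr0n//.
    apply: ge0_ler_powR; rewrite ?nnegrE ?ler0n ?ler_nat//.
    by rewrite addr_ge0// ltW.
  rewrite [X in _ <= _ + X](@big_cat_nat _ _ _ J)//= ?leq_addl//.
  rewrite addrCA lerDl addr_ge0 ?mulr_ge0 ?L1_coef_ge0//.
  apply: sumr_ge0 => j _; rewrite mulr_ge0 ?L1_diff_ge0// subr_ge0 zmax//.
  by rewrite (leq_trans (leq_subr _ _)).
move=> /le_trans/(_ HH); rewrite mulrA mulrC -ler_pdivlMr ?(mulr_gt0 c0 kap0)//.
by lra.
Qed.

(** Divide [lag_le] by [J], with [J * tau] comparable to [theta]: the derivative contributes a term
    of order A theta^alpha, brought below eps by the choice of [theta], and the telescoped term is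
    at most 4 M / theta times the elapsed time. *)
Lemma caputo_time_modulus (M A eps : R) : 0 <= M -> 0 <= A -> 0 < eps ->
  exists L tau0, [/\ 0 <= L, 0 < tau0 &
  forall (tau : R) N (v : nat -> R), 0 < tau <= tau0 ->
    (forall k, (k <= N)%N -> `|v k| <= M) ->
    (forall k, (k < N)%N -> `|caputo_L1 alpha tau v k.+1| <= A) ->
    forall n m, (n <= N)%N -> (m <= N)%N ->
      `|v n - v m| <= eps + L * `|n%:R * tau - m%:R * tau| ].
Proof.
move=> M0 A0 eps0.
(* The 4 covers the [2 * A] of [lag_le] and the loss [J / J.+1 >= 1/2]; [A + 1] keeps [B] positive
   when [A] is 0. *)
pose B := 4 * (A + 1) / (alpha * (1 - alpha) * eps).
have B0 : 0 < B by rewrite divr_gt0 ?mulr_gt0//; lra.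
have [theta theta0 Htheta] := L1_rate_window alpha01 B0.
exists (4 * M / theta), (theta / 4); split; [by rewrite divr_ge0 ?mulr_ge0// ltW|by rewrite divr_gt0|].
move=> tau N v /andP[t0 tt] vM vA.
have [J [J0 Jth thJ]] := window_size t0 tt.
have J0' : (0 : R) < J%:R by rewrite ltr0n.
have onesided (w : nat -> R) n l : (forall k, (k <= N)%N -> `|w k| <= M) ->
    (forall k, (k < N)%N -> `|caputo_L1 alpha tau w k.+1| <= A) -> (n <= N)%N ->
    w n - w (n - l)%N <= eps + 4 * M / theta * (l%:R * tau).
  move=> wM wA nN; have := lag_le l t0 J0 wM wA A0 nN.
  have := Htheta _ _ t0 Jth; set c := cst tau => Hc.
  have c0 : 0 < c by exact: L1_rate_gt0.
  set kap := alpha * _ * _ => Hlag.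
  have kap0 : 0 < kap by rewrite !mulr_gt0// powR_gt0.
  have S0 : (0 : R) < J.+1%:R by rewrite ltr0n.
  have kapE : kap = alpha * (1 - alpha) * (J.+1%:R `^ (- alpha) / J.+1%:R).
    have e : - (1 + alpha) = - alpha - 1 by ring.
    by rewrite /kap e powRB ?(gt_eqF S0) ?implybT// powRr1// ltW.
  have h1 : 2 * A / (c * kap) <= eps * J%:R.
    rewrite ler_pdivrMr ?(mulr_gt0 c0 kap0)//.
    have : B * (alpha * (1 - alpha) * eps) <= c * J.+1%:R `^ (- alpha) * (alpha * (1 - alpha) * eps).
      by rewrite ler_wpM2r// !mulr_ge0// ltW.
    rewrite {1}/B divfK ?gt_eqF ?mulr_gt0// => HB.
    have -> : eps * J%:R * (c * kap) =
      c * J.+1%:R `^ (- alpha) * (alpha * (1 - alpha) * eps) * (J%:R / J.+1%:R).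
      by rewrite kapE; field; rewrite gt_eqF.
    have hJ : 1 / 2 <= J%:R / J.+1%:R :> R.
      rewrite ler_pdivrMr// mulrAC ler_pdivlMr// mul1r mulr_natr mulr2n -natr1 lerD2l.
      by rewrite ler1n.
    apply: (@le_trans _ _ (4 * (A + 1) * (1 / 2))); first by lra.
    by apply: ler_pM => //; lra.
  have h2 : 2 * M * l%:R <= 4 * M / theta * (l%:R * tau) * J%:R.
    have -> : 4 * M / theta * (l%:R * tau) * J%:R =
      (2 * M * l%:R) * ((2 * J%:R * tau) / theta) by field; rewrite gt_eqF.
    by rewrite ler_peMr ?mulr_ge0// ler_pdivlMr// mul1r.
  move: Hlag; rewrite -ler_pdivlMr// => /le_trans; apply.
  by rewrite ler_pdivrMr//; lra.
have abs_le n m : (m <= n)%N -> (n <= N)%N ->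
    `|v n - v m| <= eps + 4 * M / theta * `|n%:R * tau - m%:R * tau|.
  move=> mn nN; rewrite -mulrBl -natrB// normrM (ger0_norm (ler0n _ _)) (ger0_norm (ltW t0)).
  have vm : v m = v (n - (n - m))%N by rewrite subKn.
  rewrite ler_norml; apply/andP; split; last by rewrite vm; exact: onesided.
  have := onesided (fun k => - v k) n (n - m)%N.
  rewrite -vm => /(_ _ _ nN) H.
  rewrite lerNl opprB; apply: le_trans (H _ _); first by rewrite opprK addrC.
    by move=> k kN; rewrite normrN vM.
  move=> k kN; rewrite -normrN (_ : - _ = caputo_L1 alpha tau v k.+1) ?vA//.
  rewrite !(caputo_L1E alpha01 _ _ (leqnn k)) -mulrN; congr (_ * _).
  by under eq_bigr do rewrite mulrN; rewrite sumrN; ring.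
move=> n m nN mN; have [mn|nm] := leqP m n; first exact: abs_le.
by rewrite distrC [X in _ <= _ + _ * X]distrC; apply: abs_le => //; exact: ltnW.
Qed.

End time_modulus.

(** * Regularization of the initial datum *)

Section squared_norm.
Variables (R : realType) (d : nat).
Implicit Types x y z : 'rV[R]_d.

Definition sqnorm x : R := \sum_(i < d) x 0 i ^+ 2.

Lemma sqnorm_ge0 x : 0 <= sqnorm x.
Proof. by apply: sumr_ge0 => i _; exact: sqr_ge0. Qed.

Lemma sqnormZ c x : sqnorm (c *: x) = c ^+ 2 * sqnorm x.
Proof. by rewrite /sqnorm mulr_sumr; apply: eq_bigr => i _; rewrite mxE exprMn. Qed.

Lemma sqnorm_parallelogram x y :
  sqnorm (x + y) + sqnorm (x - y) = 2 * sqnorm x + 2 * sqnorm y.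
Proof.
rewrite /sqnorm !mulr_sumr -!big_split/=; apply: eq_bigr => i _.
by rewrite !mxE; ring.
Qed.

Lemma enormE x : enorm x = Num.sqrt (sqnorm x). Proof. by []. Qed.

Lemma sqr_enorm x : enorm x ^+ 2 = sqnorm x.
Proof. by rewrite enormE sqr_sqrtr// sqnorm_ge0. Qed.

Lemma enorm_ge0 x : 0 <= enorm x. Proof. exact: sqrtr_ge0. Qed.

Lemma enormZ c x : enorm (c *: x) = `|c| * enorm x.
Proof. by rewrite !enormE sqnormZ sqrtrM ?sqr_ge0// sqrtr_sqr. Qed.

Lemma ler_coord_enorm x i : `|x 0 i| <= enorm x.
Proof.
rewrite -sqrtr_sqr enormE ler_wsqrtr// /sqnorm (bigD1 i)//= lerDl.
by apply: sumr_ge0 => j _; exact: sqr_ge0.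
Qed.

Lemma enorm_gt0 x : x != 0 -> 0 < enorm x.
Proof.
move=> x0; rewrite lt_neqAle enorm_ge0 andbT eq_sym.
apply: contra_neq x0 => e0; apply/rowP => i; rewrite mxE.
by apply/eqP; rewrite -normr_le0 -e0 ler_coord_enorm.
Qed.

End squared_norm.

Lemma family_sup (R : realType) (I : Type) (i0 : I) (F : I -> R) (B : R) :
  (forall i, F i <= B) ->
  exists2 s, forall i, F i <= s & forall c, (forall i, F i <= c) -> s <= c.
Proof.
move=> FB; exists (sup [set F i | i in [set: I]]).
  move=> i; apply: ub_le_sup; last by exists i.
  by exists B => _ [j _ <-].
move=> c Fc; apply: ge_sup; first by exists (F i0); exists i0.
by move=> _ [j _ <-].
Qed.

Section lasry_lions.
Variables (R : realType) (d : nat).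
Implicit Types (f g : 'rV[R]_d -> R).

(* Equivalent, for bounded f, to uniform continuity; the quadratic form is what
   inf-convolution with K |x - y|^2 needs. *)
Definition quad_modulus f : Prop := forall eps : R, 0 < eps -> exists2 K, 0 <= K &
  forall x y, `|f x - f y| <= eps + K * sqnorm (x - y).

(* The double envelope g = sup_y (inf_q (f q + K |y - q|^2) - 2 K |x - y|^2):
   the sup makes g semiconvex, and since 2 K > K it does not destroy the
   semiconcavity of the inner inf-convolution. *)
Lemma lasry_lions_regularization f (eps : R) : fbounded f -> quad_modulus f -> 0 < eps ->
  exists g K, [/\ 0 <= K, forall x, `|g x - f x| <= eps &
    forall x z, `|g (x + z) + g (x - z) - 2 * g x| <= K * sqnorm z].
Proof.
move=> [M fM] fmod eps0; have [K K0 fK] := fmod _ eps0.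
have Ks (x : 'rV[R]_d) : 0 <= K * sqnorm x by rewrite mulr_ge0 ?sqnorm_ge0.
(* The inner infimum is obtained as minus the supremum [p0] of the opposite family. *)
have /choice [p0 pP] : forall x : 'rV[R]_d, exists s : R,
    (forall y, - (f y + K * sqnorm (x - y)) <= s) /\
    (forall c, (forall y, - (f y + K * sqnorm (x - y)) <= c) -> s <= c).
  move=> x; have [|s] := @family_sup R _ x (fun y => - (f y + K * sqnorm (x - y))) M.
    by move=> y; have := fM y; have := Ks (x - y); rewrite ler_norml => ? /andP[]; lra.
  by exists s.
pose p x := - p0 x.
have ple x y : p x <= f y + K * sqnorm (x - y).
  by have := (pP x).1 y; rewrite /p; lra.
have pge x c : (forall y, c <= f y + K * sqnorm (x - y)) -> c <= p x.
  move=> H; have : p0 x <= - c by apply: (pP x).2 => y; have := H y; lra.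
  by rewrite /p; lra.
have sq0 : sqnorm (0 : 'rV[R]_d) = 0.
  by rewrite /sqnorm big1// => i _; rewrite mxE expr0n.
have p_le x : p x <= f x by have := ple x x; rewrite subrr sq0 mulr0 addr0.
have p_ge x : f x - eps <= p x.
  by apply: pge => y; have := fK x y; rewrite ler_norml => /andP[]; lra.
have semiconcave y z : p (y + z) + p (y - z) <= 2 * p y + 2 * (K * sqnorm z).
  have : (p (y + z) + p (y - z)) / 2 - K * sqnorm z <= p y.
    apply: pge => q; have := ple (y + z) q; have := ple (y - z) q.
    have := sqnorm_parallelogram (y - q) z.
    rewrite (addrAC y (- q) z) (addrAC y (- q) (- z)) => /(congr1 (fun t => K * t)).
    by lra.
  by lra.
have /choice [g gP] : forall x : 'rV[R]_d, exists s : R,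
    (forall y, p y - 2 * (K * sqnorm (x - y)) <= s) /\
    (forall c, (forall y, p y - 2 * (K * sqnorm (x - y)) <= c) -> s <= c).
  move=> x; have [|s] := @family_sup R _ x (fun y => p y - 2 * (K * sqnorm (x - y))) M.
    move=> y; have := fM y; have := Ks (x - y); have := p_le y.
    by rewrite ler_norml => ? ? /andP[]; lra.
  by exists s.
have gge x y : p y - 2 * (K * sqnorm (x - y)) <= g x by exact: (gP x).1.
have gle x c : (forall y, p y - 2 * (K * sqnorm (x - y)) <= c) -> g x <= c.
  exact: (gP x).2.
exists g, (4 * K); split; first by rewrite mulr_ge0.
  move=> x; rewrite ler_norml; apply/andP; split.
    by have := gge x x; have := p_ge x; rewrite subrr sq0; lra.
  suff : g x <= f x + eps by lra.
  apply: gle => y; have := fK x y; have := p_le y; have := Ks (x - y).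
  by rewrite ler_norml => ? ? /andP[]; lra.
move=> x z; rewrite ler_norml; apply/andP; split.
  suff : g x <= (g (x + z) + g (x - z)) / 2 + 2 * (K * sqnorm z) by lra.
  apply: gle => y; have := gge (x + z) y; have := gge (x - z) y.
  have := sqnorm_parallelogram (x - y) z.
  rewrite (addrAC x (- y) z) (addrAC x (- y) (- z)) => /(congr1 (fun t => K * t)).
  by lra.
suff : g (x + z) <= 2 * g x + 4 * (K * sqnorm z) - g (x - z) by lra.
apply: (gle _ _) => y1.
suff : g (x - z) <= 2 * g x + 4 * (K * sqnorm z) -
    (p y1 - 2 * (K * sqnorm (x + z - y1))) by lra.
apply: gle => y2.
(* The midpoint [y] is the competitor in [g x]. Semiconcavity of [p] costs 2 K |e|^2, the
   parallelogram law returns 4 K |z - e|^2 from the outer penalty, and |e|^2 <= 2 |z|^2 + 2 |z -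
   e|^2 leaves exactly 4 K |z|^2. *)
pose y := 2^-1 *: (y1 + y2); pose e := 2^-1 *: (y1 - y2).
have E1 : y1 = y + e by apply/rowP => i; rewrite !mxE; field.
have E2 : y2 = y - e by apply/rowP => i; rewrite !mxE; field.
have := semiconcave y e; rewrite -E1 -E2.
have := gge x y.
have := sqnorm_parallelogram (x - y) (z - e).
have -> : x - y + (z - e) = x + z - y1 by rewrite E1; apply/rowP => i; rewrite !mxE; ring.
have -> : x - y - (z - e) = x - z - y2 by rewrite E2; apply/rowP => i; rewrite !mxE; ring.
move=> /(congr1 (fun t => K * t)).
have : K * sqnorm e <= K * (2 * sqnorm z + 2 * sqnorm (z - e)).
  rewrite ler_wpM2l// -sqnorm_parallelogram subKr.
  by rewrite lerDr sqnorm_ge0.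
by lra.
Qed.

End lasry_lions.

(** * Pointwise bounds from a finite X^r norm *)

Section Xspace_theory.
Variables (R : realType) (d : nat).
Hypothesis d_gt0 : (0 < d)%N.
Implicit Types (f : 'rV[R]_d -> R) (x y : 'rV[R]_d).
Notation dist := (fun x y : 'rV[R]_d => enorm (x - y)).

Lemma sup_norm_le f M : (sup_norm setT f <= M%:E)%E -> forall x, `|f x| <= M.
Proof.
move=> fM x; rewrite -lee_fin; apply: le_trans fM.
by apply: ereal_sup_ubound; exists x.
Qed.

Lemma sup_norm_ge0 f : (0 <= sup_norm setT f)%E.
Proof.
apply: (@le_trans _ _ (`|f 0|)%:E); first by rewrite lee_fin.
by apply: ereal_sup_ubound; exists 0.
Qed.

Lemma quotient_sup_le (osc : 'rV[R]_d -> 'rV[R]_d -> R) s M :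
  (quotient_sup setT osc dist s <= M%:E)%E ->
  forall x y, x != y -> osc x y <= M * enorm (x - y) `^ s.
Proof.
move=> qM x y xy; rewrite -ler_pdivrMr ?powR_gt0 ?enorm_gt0 ?subr_eq0//.
rewrite -lee_fin; apply: le_trans qM; apply: ereal_sup_ubound.
by exists (x, y) => //; split=> //; apply/eqP.
Qed.

(** In dimension 0 there are no two distinct points and the supremum over the empty set is [-oo];
    [d_gt0] supplies a pair of points. *)
Lemma quotient_sup_ge0 (osc : 'rV[R]_d -> 'rV[R]_d -> R) s :
  (forall x y, 0 <= osc x y) -> (0 <= quotient_sup setT osc dist s)%E.
Proof.
move=> osc0; pose e : 'rV[R]_d := const_mx 1.
have e0 : e <> 0.
  by move=> /rowP/(_ (Ordinal d_gt0))/eqP; rewrite !mxE oner_eq0.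
apply: (@le_trans _ _ (osc e 0 / enorm (e - 0) `^ s)%:E).
  by rewrite lee_fin divr_ge0// powR_ge0.
by apply: ereal_sup_ubound; exists (e, 0).
Qed.

Lemma derive_grad f x y : differentiable f x ->
  'D_y f x = \sum_(i < d) y 0 i * grad f x 0 i.
Proof.
move=> df; rewrite deriveE//.
have -> : y = \sum_(i < d) y 0 i *: delta_mx 0 i.
  rewrite [LHS]matrix_sum_delta big_ord1.
  by [].
rewrite linear_sum; apply: eq_bigr => i _.
rewrite linearZ/= mxE deriveE//; congr (_ * _).
rewrite summxE (bigD1 i)//= !mxE !eqxx mulr1 big1 ?addr0// => j ji.
by rewrite !mxE eqxx/= eq_sym (negPf ji) mulr0.
Qed.

Lemma norm_dot_le x y : `|\sum_(i < d) x 0 i * y 0 i| <= d%:R * (enorm x * enorm y).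
Proof.
apply: le_trans (ler_norm_sum _ _ _) _.
rewrite mulr_natl; apply: (@le_trans _ _ (\sum_(i < d) enorm x * enorm y)).
  by apply: ler_sum => i _; rewrite normrM ler_pM// ler_coord_enorm.
by rewrite sumr_const card_ord.
Qed.

(* The second difference is the increment over [0, 1] of s |-> f (x + s y) + f (x - s y). *)
Lemma second_difference_le f r M : 1 < r <= 2 -> 0 <= M ->
  (forall x, differentiable f x) ->
  (forall x y, enorm (grad f x - grad f y) <= M * enorm (x - y) `^ (r - 1)) ->
  forall x y, `|f (x + y) + f (x - y) - 2 * f x| <= 2 * d%:R * M * enorm y `^ r.
Proof.
move=> /andP[r1 r2] M0 df gf x y.
pose G (s : R) := f (x + s *: y) + f (x - s *: y).
pose dG (s : R) := 'D_y f (x + s *: y) - 'D_y f (x - s *: y).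
have dline (z v : 'rV[R]_d) (s : R) :
    is_derive s 1 (fun s : R => f (z + s *: v)) ('D_v f (z + s *: v)).
  have E : (fun h : R => h^-1 *: (((fun s => f (z + s *: v)) \o shift s) (h *: (1 : R)) - f (z + s *: v))) =
           (fun h => h^-1 *: ((f \o shift (z + s *: v)) (h *: v) - f (z + s *: v))).
    apply/funext => h; have e : h *: (1 : R) = h by exact: mulr1.
    by rewrite /= e scalerDl addrCA.
  have dv : derivable f (z + s *: v) v by apply: diff_derivable.
  by split; rewrite /derivable /derive E.
have GdG (s : R) : is_derive s 1 G (dG s).
  have h2 : is_derive s 1 (fun s : R => f (x - s *: y)) (- 'D_y f (x - s *: y)).
    have := dline x (- y) s.
    have -> : (fun s : R => f (x + s *: - y)) = (fun s => f (x - s *: y)).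
      by apply/funext => t; rewrite scalerN.
    rewrite scalerN => h; suff <- : 'D_(- y) f (x - s *: y) = - 'D_y f (x - s *: y) by [].
    by rewrite !deriveE// linearN.
  exact: (is_deriveD (dline x y s) h2).
have [|c] := @MVT _ G dG 0 1 ltr01 (fun s _ => GdG s).
  by apply: derivable_within_continuous => s _; case: (GdG s).
rewrite in_itv/= => /andP[c0 c1]; rewrite subr0 mulr1 => E.
have -> : f (x + y) + f (x - y) - 2 * f x = dG c.
  by rewrite -E /G scale1r scale0r subr0 addr0; ring.
rewrite /dG !derive_grad// -sumrB.
under eq_bigr do rewrite -mulrBr.
have -> : \sum_(i < d) y 0 i * (grad f (x + c *: y) 0 i - grad f (x - c *: y) 0 i) =
  \sum_(i < d) y 0 i * (grad f (x + c *: y) - grad f (x - c *: y)) 0 i.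
  by apply: eq_bigr => i _; rewrite !mxE.
apply: le_trans (norm_dot_le _ _) _.
have -> : 2 * d%:R * M * enorm y `^ r = d%:R * (enorm y * (M * (2 * enorm y `^ (r - 1)))).
  rewrite -(@mulr_powRB1 _ (enorm y) r) ?enorm_ge0//; first by ring.
  exact: lt_trans r1.
rewrite !ler_wpM2l ?enorm_ge0//; apply: le_trans (gf _ _) _; rewrite ler_wpM2l//.
have -> : x + c *: y - (x - c *: y) = (2 * c) *: y.
  by apply/rowP => i; rewrite !mxE; ring.
have c2 : 0 <= 2 * c by rewrite mulr_ge0// ltW.
rewrite enormZ ger0_norm// powRM ?enorm_ge0// ler_wpM2r ?powR_ge0//.
apply: (@le_trans _ _ (2 `^ (r - 1))).
  by apply: ge0_ler_powR; rewrite ?nnegrE//; lra.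
rewrite -[leRHS]powRr1//; apply: ler_powR; first by rewrite ler1n.
by lra.
Qed.

Lemma Xnorm_bounds f r M : 0 < r <= 2 ->
  (1 < r -> forall x, differentiable f x) -> (Xnorm r f <= M%:E)%E ->
  [/\ forall x, `|f x| <= M,
      forall x y, `|f x - f y| <= M * enorm (x - y) `^ Num.min r 1 &
      forall x y, `|f (x + y) + f (x - y) - 2 * f x| <=
        (4 + 2 * d%:R) * M * Num.min (enorm y `^ r) 1 ].
Proof.
move=> /andP[r0 r2] df; rewrite /Xnorm; cbv zeta; set osc := fun x y => `|f x - f y|.
have osc0 x y : 0 <= osc x y by rewrite /osc.
have holder s : 0 < s -> (quotient_sup setT osc dist s <= M%:E)%E ->
    forall x y, `|f x - f y| <= M * enorm (x - y) `^ s.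
  move=> s0 H x y; have [->|xy] := eqVneq x y; last exact: quotient_sup_le H _ _ xy.
  rewrite !subrr normr0 enormE (_ : sqnorm 0 = 0) ?sqrtr0 ?powR0 ?mulr0 ?gt_eqF//.
  by rewrite /sqnorm big1// => i _; rewrite mxE expr0n.
have second4 : (forall x, `|f x| <= M) ->
    forall x y, `|f (x + y) + f (x - y) - 2 * f x| <= 4 * M.
  move=> fM x y; have := fM (x + y); have := fM (x - y); have := fM x.
  rewrite !ler_norml => /andP[? ?] /andP[? ?] /andP[? ?].
  by apply/andP; split; lra.
(* [A] is 2 for r <= 1, from two Hölder increments, and [2 * d%:R] for r > 1. Where |y|^r exceeds 1,
   the trivial bound [4 * M] takes over. *)
have combine (A : R) : 0 <= M -> (forall x, `|f x| <= M) -> A <= 4 + 2 * d%:R ->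
    (forall x y, `|f (x + y) + f (x - y) - 2 * f x| <= A * M * enorm y `^ r) ->
    forall x y, `|f (x + y) + f (x - y) - 2 * f x| <=
      (4 + 2 * d%:R) * M * Num.min (enorm y `^ r) 1.
  move=> M0 fM A4 H x y.
  have d0 : (0 : R) <= 2 * d%:R by rewrite mulr_ge0.
  case: (leP (enorm y `^ r) 1) => _.
    by apply: le_trans (H x y) _; rewrite ler_wpM2r ?powR_ge0// ler_wpM2r.
  rewrite mulr1; apply: le_trans (second4 fM x y) _; rewrite ler_wpM2r//; lra.
case: (leP r 1) => r1.
  move=> H; have fM : forall x, `|f x| <= M.
    apply: sup_norm_le; apply: le_trans H; rewrite leeDl//.
    exact: quotient_sup_ge0.
  have M0 : 0 <= M by apply: le_trans (fM 0).
  have Hq : (quotient_sup setT osc dist r <= M%:E)%E.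
    by apply: le_trans H; rewrite leeDr// sup_norm_ge0.
  have hold := holder r r0 Hq.
  split=> //.
  apply: (combine 2) => //; first by have : (0 : R) <= d%:R by []; lra.
  move=> x y; have := hold (x + y) x; have := hold (x - y) x.
  have -> : x + y - x = y by rewrite addrAC subrr add0r.
  have -> : x - y - x = (-1) *: y by rewrite addrAC subrr add0r scaleN1r.
  rewrite enormZ normrN1 mul1r.
  rewrite !ler_norml => /andP[? ?] /andP[? ?].
  by apply/andP; split; lra.
move=> H; set gosc := fun x y => enorm (grad f x - grad f y) in H.
have gosc0 x y : 0 <= gosc x y by exact: enorm_ge0.
have q1 := quotient_sup_ge0 1 osc0; have q2 := quotient_sup_ge0 (r - 1) gosc0.
have s0 := sup_norm_ge0 f.
have fM : forall x, `|f x| <= M.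
  by apply: sup_norm_le; apply: le_trans H; rewrite -addeA leeDl// adde_ge0.
have M0 : 0 <= M by apply: le_trans (fM 0).
split=> //.
  apply: holder => //.
  by apply: le_trans H; rewrite addeAC leeDr// adde_ge0.
have gq : (quotient_sup setT gosc dist (r - 1) <= M%:E)%E.
  by apply: le_trans H; rewrite leeDr// adde_ge0.
apply: (combine (2 * d%:R)) => //; first by lra.
apply: second_difference_le => //; [by rewrite r1 | exact: df |].
move=> x y; have [->|xy] := eqVneq x y; last exact: quotient_sup_le gq _ _ xy.
rewrite subrr enormE (_ : sqnorm 0 = 0) ?sqrtr0 ?mulr_ge0 ?powR_ge0//.
by rewrite /sqnorm big1// => i _; rewrite mxE expr0n.
Qed.

End Xspace_theory.

(** Below the distance [del] the Hölder bound is under eps; beyond it the trivial bound 2 M is at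
    most 2 M |x - y|^2 / del^2. [K] precedes [f] because it must serve all the functions D(., t) at
    once. *)
Lemma holder_quad_modulus (R : realType) (d : nat) (M p : R) : 0 <= M -> 0 < p ->
  forall eps, 0 < eps -> exists2 K, 0 <= K &
  forall f : 'rV[R]_d -> R, (forall x, `|f x| <= M) ->
    (forall x y, `|f x - f y| <= M * enorm (x - y) `^ p) ->
    forall x y, `|f x - f y| <= eps + K * sqnorm (x - y).
Proof.
move=> M0 p0 eps eps0.
pose q := eps / (M + 1); have q0 : 0 < q by rewrite divr_gt0//; lra.
pose del := q `^ p^-1; have del0 : 0 < del by exact: powR_gt0.
have K0 : 0 <= 2 * M / del ^+ 2.
  by apply: divr_ge0; [exact: mulr_ge0 | exact: sqr_ge0].
exists (2 * M / del ^+ 2) => //.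
move=> f fM fp x y; have [le_del|lt_del] := leP (enorm (x - y)) del.
  apply: ler_wpDr; first by rewrite mulr_ge0 ?sqnorm_ge0.
  apply: le_trans (fp x y) _; apply: (@le_trans _ _ (M * q)).
    rewrite ler_wpM2l//; apply: (@le_trans _ _ (del `^ p)).
      by apply: ge0_ler_powR => //; rewrite ?nnegrE ?enorm_ge0 ?(ltW del0) ?(ltW p0).
    by rewrite -powRrM mulVf ?gt_eqF// powRr1// ltW.
  rewrite /q mulrCA ger_pMr// ler_pdivrMr; lra.
apply: ler_wpDl; first exact: ltW.
apply: (@le_trans _ _ (2 * M)).
  by have := fM x; have := fM y; rewrite !ler_norml => /andP[? ?] /andP[? ?]; lra.
have d2 : 0 < del ^+ 2 by exact: exprn_gt0.
rewrite mulrAC ler_pdivlMr// ler_wpM2l ?mulr_ge0//.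
by rewrite -sqr_enorm lerXn2r// ?nnegrE ?enorm_ge0// ltW.
Qed.

(** * The implicit scheme *)

Section implicit_scheme.
Variables (R : realType) (d : nat) (alpha h tau : R) (w : 'rV[int]_d -> R).
Hypothesis alpha01 : 0 < alpha < 1.
Hypothesis tau_gt0 : 0 < tau.
Hypothesis w_ge0 : forall b, b != 0 -> 0 <= w b.
Hypothesis w_fin : (\esum_(b in nonzero_lattice d) (w b)%:E < +oo)%E.
Notation cst := (tau `^ (- alpha) / Gamma (2 - alpha)).
Notation L := (discrete_op h w).
Notation Lam := (total_rate w).
Implicit Types (x y : 'rV[R]_d) (f g : 'rV[R]_d -> R).

Let cst_gt0 : 0 < cst. Proof. exact: L1_rate_gt0. Qed.
Let Lam_ge0 : 0 <= Lam. Proof. exact: total_rate_ge0. Qed.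

(* Knaster-Tarski: the greatest subsolution of f = Phi f with |f| <= M. *)
Lemma implicit_step (D F : 'rV[R]_d -> R) : (forall x, 0 <= D x) -> fbounded F ->
  exists2 V, fbounded V & forall x, cst * (V x - F x) = D x * L V x.
Proof.
have := cst_gt0; move: (cst) => c c0.
move=> D0 /fbounded_ge0[M M0 FM].
(* The equation solved for its diagonal value; nonnegative jump weights make [Phi] monotone. *)
pose Phi f x := (c * F x + D x * neighbor_sum h w f x) / (c + D x * Lam).
have den x : 0 < c + D x * Lam by rewrite ltr_wpDr ?mulr_ge0.
have PhiM f : (forall x, `|f x| <= M) -> forall x, `|Phi f x| <= M.
  move=> fM x; rewrite /Phi normrM normfV (ger0_norm (ltW (den x))) ler_pdivrMr//.
  apply: le_trans (ler_normD _ _) _; rewrite !normrM (ger0_norm (D0 x)).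
  rewrite (ger0_norm (ltW c0)) mulrDr lerD//.
    by rewrite mulrC ler_wpM2r ?(ltW c0).
  rewrite mulrCA ler_wpM2l// mulrC.
  exact: ler_norm_neighbor_sum_cst.
have Phi_le f g : fbounded f -> fbounded g -> (forall x, f x <= g x) ->
    forall x, Phi f x <= Phi g x.
  move=> bf bg fg x; rewrite /Phi ler_wpM2r ?invr_ge0 ?(ltW (den x))//.
  by rewrite lerD2l ler_wpM2l// le_neighbor_sum.
pose S := {f : 'rV[R]_d -> R | (forall x, `|f x| <= M) /\ (forall x, f x <= Phi f x)}.
have s0 : S.
  exists (fun=> - M); split=> [x|x]; first by rewrite normrN ger0_norm.
  rewrite /Phi neighbor_sum_cst// ler_pdivlMr//.
  have : c * (- M) <= c * F x.
    rewrite ler_wpM2l ?(ltW c0)//.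
    by have := FM x; rewrite ler_norml => /andP[].
  by lra.
have /choice [V VP] : forall x, exists s : R,
    (forall f : S, proj1_sig f x <= s) /\
    (forall c, (forall f : S, proj1_sig f x <= c) -> s <= c).
  move=> x; have [|s] := @family_sup R S s0 (fun f : S => proj1_sig f x) M; last by exists s.
  by move=> [f [fM fP]] /=; have := fM x; rewrite ler_norml => /andP[].
have VM x : `|V x| <= M.
  rewrite ler_norml; apply/andP; split.
    apply: le_trans ((VP x).1 s0); case: (s0) => f [fM _] /=.
    by have := fM x; rewrite ler_norml => /andP[].
  by apply: (VP x).2 => -[f [fM _]] /=; have := fM x; rewrite ler_norml => /andP[].
have bV : fbounded V by exists M.
have V_le x : V x <= Phi V x.
  apply: (VP x).2 => -[f [fM fP]] /=; apply: le_trans (fP x) _.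
  apply: Phi_le => //; first by exists M.
  move=> z; pose sf : S := exist _ f (conj fM fP); exact: ((VP z).1 sf).
have V_ge x : Phi V x <= V x.
  have PP : (forall z, `|Phi V z| <= M) /\ (forall z, Phi V z <= Phi (Phi V) z).
    split; first exact: PhiM.
    apply: Phi_le => //; exists M; exact: PhiM.
  pose sf : S := exist _ (Phi V) PP; exact: ((VP x).1 sf).
exists V => // x; have VE : V x = Phi V x by apply/eqP; rewrite eq_le V_le V_ge.
have : V x * (c + D x * Lam) = c * F x + D x * neighbor_sum h w V x.
  by rewrite {1}VE /Phi divfK// gt_eqF.
by rewrite discrete_opE//; lra.
Qed.

Definition L1_solution (D : nat -> 'rV[R]_d -> R) (N : nat) (V : nat -> 'rV[R]_d -> R) :=
  (forall n, (n <= N)%N -> fbounded (V n)) /\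
  forall n x, (n < N)%N -> caputo_L1 alpha tau (V^~ x) n.+1 = D n.+1 x * L (V n.+1) x.

Lemma L1_solution_exists (D : nat -> 'rV[R]_d -> R) v0 N :
  (forall n x, 0 <= D n x) -> fbounded v0 ->
  exists2 V, V 0%N = v0 & L1_solution D N V.
Proof.
move=> D0 bv0.
have /choice [sol solP] : forall p : nat * ('rV[R]_d -> R), exists V, fbounded p.2 ->
    fbounded V /\ forall x, cst * (V x - p.2 x) = D p.1 x * L V x.
  move=> [n F] /=; have [bF|nbF] := pselect (fbounded F); last by exists F.
  by have [V bV VP] := implicit_step (D0 n) bF; exists V.
pose mem (n : nat) (V : nat -> 'rV[R]_d -> R) x :=
  \sum_(0 <= j < n) L1_diff alpha j * V (n - j)%N x + L1_coef alpha n * V 0%N x.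
(* Each step needs all earlier values, so the recursion carries the whole history: [H n] is correct
   up to index [n], and [V] is its diagonal. *)
pose H := fix H n : nat -> 'rV[R]_d -> R := if n is n'.+1 then
  (fun k => if k == n'.+1 then sol (n'.+1, mem n' (H n')) else H n' k) else fun=> v0.
pose V n := H n n.
have HV m k : (k <= m)%N -> H m k = V k.
  elim: m => [|m IH]; first by rewrite leqn0 => /eqP ->.
  rewrite leq_eqVlt => /predU1P[->//|km] /=.
  by rewrite ifN ?IH// neq_ltn km.
have memH n : mem n (H n) = mem n V.
  apply/funext => x; rewrite /mem HV//; congr (_ + _).
  by apply: eq_bigr => j _; rewrite HV// leq_subr.
have VS n : V n.+1 = sol (n.+1, mem n V) by rewrite {1}/V /= eqxx memH.
have bmem n : (forall k, (k <= n)%N -> fbounded (V k)) -> fbounded (mem n V).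
  move=> bV; apply: fboundedD; last first.
    by apply: fboundedM; [exact: fbounded_cst | exact: bV].
  apply: fbounded_sum => j _; apply: fboundedM; first exact: fbounded_cst.
  by apply: bV; exact: leq_subr.
have bV n : fbounded (V n).
  elim/ltn_ind: n => -[_//|n IH].
  rewrite VS; apply: (solP (n.+1, mem n V) _).1 => /=.
  by apply: bmem => k kn; exact: IH.
exists V => //; split=> // n x _.
rewrite (caputo_L1E alpha01 _ _ (leqnn n)).
have := (solP (n.+1, mem n V) (bmem n (fun k _ => bV k))).2 x.
by rewrite -VS.
Qed.

Lemma caputo_L1B (u v : nat -> R) n :
  caputo_L1 alpha tau (fun k => u k - v k) n = caputo_L1 alpha tau u n - caputo_L1 alpha tau v n.
Proof.
rewrite /caputo_L1 -mulrBr; congr (_ * _).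
under eq_bigr do rewrite mulrBr.
by rewrite sumrB; ring.
Qed.

(** The operator acts in space and the L1 derivative is a finite linear combination in time, so they
    commute; this turns the scheme into the equation for [L V]. *)
Lemma discrete_op_caputo N (V : nat -> 'rV[R]_d -> R) n x : (n < N)%N ->
  (forall k, (k <= N)%N -> fbounded (V k)) ->
  L (fun y => caputo_L1 alpha tau (V^~ y) n.+1) x =
  caputo_L1 alpha tau (fun k => L (V k) x) n.+1.
Proof.
move=> nN bV; rewrite (caputo_L1E alpha01 _ _ (leqnn n)).
have -> : (fun y => caputo_L1 alpha tau (V^~ y) n.+1) = fun y => cst * (V n.+1 y -
    (\sum_(0 <= j < n) L1_diff alpha j * V (n - j)%N y + L1_coef alpha n * V 0%N y)).
  by apply/funext => y; rewrite (caputo_L1E alpha01 _ _ (leqnn n)).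
have bS j : fbounded (fun y => L1_diff alpha j * V (n - j)%N y).
  apply: fboundedM; first exact: fbounded_cst.
  by apply: bV; rewrite (leq_trans (leq_subr _ _))// ltnW.
have bsum : fbounded (fun y => \sum_(0 <= j < n) L1_diff alpha j * V (n - j)%N y).
  by apply: fbounded_sum => j _.
have b0 : fbounded (fun y => L1_coef alpha n * V 0%N y).
  by apply: fboundedM; [exact: fbounded_cst | exact: bV].
have bn1 : fbounded (V n.+1) by exact: bV.
rewrite discrete_opZ//; last by apply: fboundedB => //; exact: fboundedD.
congr (_ * _); rewrite discrete_opB//; last exact: fboundedD.
rewrite discrete_opD// discrete_opZ//; last exact: bV.
rewrite discrete_op_sum//; congr (_ - (_ + _)).
apply: eq_bigr => j _; rewrite discrete_opZ//.
by apply: bV; rewrite (leq_trans (leq_subr _ _))// ltnW.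
Qed.

End implicit_scheme.

(** * Estimates uniform in h and tau *)

Section uniform_estimates.
Variables (R : realType) (d : nat) (alpha T : R).
Hypothesis alpha01 : 0 < alpha < 1.

Lemma scheme_estimates (C0 MD : R) : 0 <= C0 -> exists E tau0, [/\ 0 <= E, 0 < tau0 &
  forall (h tau : R) (w : 'rV[int]_d -> R) (D : nat -> 'rV[R]_d -> R) N,
  0 < tau <= tau0 -> N%:R * tau <= T ->
  (forall b, b != 0 -> 0 <= w b) ->
  (\esum_(b in nonzero_lattice d) (w b)%:E < +oo)%E ->
  (forall n x, 0 <= D n x <= MD) ->
  (forall (W : nat -> 'rV[R]_d -> R) G S0, 0 <= G ->
    (forall n, (n <= N)%N -> fbounded (W n)) ->
    (forall x, `|W 0%N x| <= S0) ->
    (forall n x, (n < N)%N ->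
      `|caputo_L1 alpha tau (W^~ x) n.+1 - D n.+1 x * discrete_op h w (W n.+1) x| <= G) ->
    forall n x, (n <= N)%N -> `|W n x| <= E * (S0 + G)) /\
  (forall (V : nat -> 'rV[R]_d -> R) S0,
    (forall n x, `|discrete_op h w (D n) x| <= C0) ->
    L1_solution alpha h tau w D N V ->
    (forall x, `|discrete_op h w (V 0%N) x| <= S0) ->
    forall n x, (n <= N)%N -> `|discrete_op h w (V n) x| <= E * S0)].
Proof.
move=> C00; have [E [tau0 [E0 tau00 gronwall]]] := caputo_gronwall alpha01 T C00.
exists E, tau0; split=> // h tau w D N ttau NT w0 wfin HD.
have t0 : 0 < tau by case/andP: ttau.
have D0 n x : 0 <= D n x by case/andP: (HD n x).
have DM n x : D n x <= MD by case/andP: (HD n x).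
have MD0 : 0 <= MD by apply: le_trans (DM 0%N 0).
have Lam0 : 0 <= total_rate w by exact: total_rate_ge0.
(* [K] depends on h through the total rate, whereas [E] and [tau0] were fixed before it and depend
   only on alpha, T and [C0]. *)
pose K := total_rate w * MD.
have K0 : 0 <= K by rewrite mulr_ge0.
have DK n x : total_rate w * D n x <= K by rewrite ler_wpM2l.
split=> [W G S0 G0 bW W0 HW n x nN|V S0 LD [bV HV] V0 n x nN].
  apply: (gronwall _ tau N W K G S0) => // {x nN}n S x nN WS.
  have S0' : 0 <= S by apply: le_trans (WS x).
  have := HW n x nN; set cap := caputo_L1 _ _ _ _; set LW := discrete_op _ _ _ _ => H.
  have -> : cap + K * W n.+1 x = (D n.+1 x * LW + K * W n.+1 x) + (cap - D n.+1 x * LW) by ring.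
  apply: le_trans (ler_normD _ _) _; rewrite lerD//.
  apply: (@le_trans _ _ (K * S)); first exact: diffusion_norm_le.
  by rewrite ler_wpM2r// lerDl.
rewrite -[S0]addr0.
apply: (gronwall _ tau N (fun n => discrete_op h w (V n)) K 0 S0) => //.
  by move=> k kN; apply: fbounded_discrete_op => //; exact: bV.
move=> {x nN}n S x nN VS; rewrite addr0.
rewrite -(@discrete_op_caputo R d alpha h tau w alpha01 w0 wfin N V n x nN bV).
have -> : (fun y => caputo_L1 alpha tau (V^~ y) n.+1) =
    fun y => D n.+1 y * discrete_op h w (V n.+1) y.
  by apply/funext => y; rewrite HV.
apply: dual_diffusion_norm_le => //.
by exists MD => y; rewrite ger0_norm.
Qed.

Lemma scheme_bound (MD M0 : R) : exists M tau0, [/\ 0 <= M, 0 < tau0 &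
  forall (h tau : R) (w : 'rV[int]_d -> R) (D : nat -> 'rV[R]_d -> R) N V,
  0 < tau <= tau0 -> N%:R * tau <= T ->
  (forall b, b != 0 -> 0 <= w b) ->
  (\esum_(b in nonzero_lattice d) (w b)%:E < +oo)%E ->
  (forall n x, 0 <= D n x <= MD) ->
  (forall x, `|V 0%N x| <= M0) ->
  L1_solution alpha h tau w D N V ->
  forall n x, (n <= N)%N -> `|V n x| <= M].
Proof.
have [E [tau0 [E0 tau00 H]]] := scheme_estimates MD (lexx 0).
exists (E * `|M0|), tau0; split=> //; first by rewrite mulr_ge0.
move=> h tau w D N V ttau NT w0 wfin HD V0 [bV HV] n x nN.
have [est _] := H h tau w D N ttau NT w0 wfin HD.
rewrite -[`|M0|]addr0; apply: (est V 0 `|M0|) => // [y|k y kN].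
  by apply: le_trans (V0 y) _; exact: ler_norm.
by rewrite HV// subrr normr0.
Qed.

(** Since r <= 2, |x|^2 <= |x|^r inside the unit ball; outside it the minimum is 1 and the bound [M]
    applies. This fits a C^{1,1} estimate to the moment condition on the weights. *)
Lemma sqnorm_le_min_powR (r : R) (x : 'rV[R]_d) (A K M : R) : 0 <= r <= 2 ->
  0 <= K -> 0 <= M -> A <= K * sqnorm x -> A <= M ->
  A <= (K + M) * Num.min (enorm x `^ r) 1.
Proof.
move=> /andP[r0 r2] K0 M0 AK AM; have e0 := enorm_ge0 x.
have pr0 : 0 <= enorm x `^ r by exact: powR_ge0.
have [e1|/ltW e1] := leP (enorm x) 1.
  have s1 : sqnorm x <= 1 by rewrite -sqr_enorm -[leRHS](expr1n _ 2) lerXn2r// nnegrE.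
  have sr : sqnorm x <= enorm x `^ r.
    rewrite -sqr_enorm; have [->|en0] := eqVneq (enorm x) 0.
      by rewrite expr0n/= powR_ge0.
    by rewrite -powR_mulrn//; apply: ger_powR => //; rewrite lt_neqAle eq_sym en0 e0.
  case: (leP (enorm x `^ r) 1) => _; apply: le_trans AK _.
    apply: le_trans (ler_wpM2l K0 sr) _.
    by rewrite ler_wpM2r// lerDl.
  by apply: le_trans (ler_wpM2l K0 s1) _; rewrite !mulr1 lerDl.
rewrite min_r; first by rewrite mulr1 (le_trans AM)// lerDr.
by rewrite -[leLHS](powRr0 (enorm x)) ler_powR.
Qed.

Lemma scheme_equicontinuity (r MD C0 C : R) (DD : set ('rV[R]_d -> R))
    (u0 : 'rV[R]_d -> R) (eps : R) :
  0 <= r <= 2 -> 0 <= C0 -> 0 <= C -> fbounded u0 -> quad_modulus u0 ->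
  (forall f, DD f -> forall x, 0 <= f x <= MD) ->
  (forall e : R, 0 < e -> exists2 K, 0 <= K &
    forall f, DD f -> forall x y, `|f x - f y| <= e + K * sqnorm (x - y)) ->
  0 < eps -> exists L tau0, [/\ 0 <= L, 0 < tau0 &
  forall (h tau : R) (w : 'rV[int]_d -> R) (D : nat -> 'rV[R]_d -> R) N U,
  0 < tau <= tau0 -> N%:R * tau <= T ->
  (forall b, b != 0 -> 0 <= w b) ->
  (\esum_(b in nonzero_lattice d) (w b)%:E < +oo)%E ->
  (\esum_(b in nonzero_lattice d)
     (Num.min (enorm (lattice_pt h b) `^ r) 1 * w b)%:E <= C%:E)%E ->
  (forall n, DD (D n)) -> (forall n x, `|discrete_op h w (D n) x| <= C0) ->
  U 0%N = u0 -> L1_solution alpha h tau w D N U ->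
  forall n m x y, (n <= N)%N -> (m <= N)%N ->
    `|U n x - U m y| <= eps + L * (sqnorm (x - y) + `|n%:R * tau - m%:R * tau|)].
Proof.
move=> r02 C00 Cge0 bu0 mod_u0 DM Dmod eps0.
have [[f0 DDf0]|noDD] := pselect (exists f, DD f); last first.
  exists 0, 1; split=> // h tau w D N U _ _ _ _ _ HDD.
  by case: noDD; exists (D 0%N); exact: HDD.
have MD0 : 0 <= MD by have /andP[? ?] := DM f0 DDf0 0; exact: le_trans (_ : f0 0 <= _).
have [E [tau1 [E0 tau10 est]]] := scheme_estimates MD C00.
(* Error budget in units of [e1]: replacing U by V at both points costs [2 * E], the space modulus
   of V costs [E * (3 + 1)], its time modulus costs 1. The 3 is twice the regularization error plus
   the modulus of [u0], the other 1 the modulus of D times the bound [B] on L V. *)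
pose e1 := eps / (6 * E + 1).
have e10 : 0 < e1 by rewrite divr_gt0// ltr_wpDl// mulr_ge0.
have [v0 [K1 [K10 v0u0 v0d2]]] := lasry_lions_regularization bu0 mod_u0 e10.
have [Mu Mu0 HMu] := fbounded_ge0 bu0.
pose Mv := Mu + e1.
have Mv0 : 0 <= Mv by rewrite addr_ge0// ltW.
have v0M x : `|v0 x| <= Mv.
  move: (v0u0 x) (HMu x); rewrite /Mv !ler_norml; clear.
  by move=> /andP[? ?] /andP[? ?]; apply/andP; split; lra.
pose K2 := K1 + 4 * Mv.
have K20 : 0 <= K2 by rewrite addr_ge0 ?mulr_ge0.
have v0min x y : `|v0 (x + y) + v0 (x - y) - 2 * v0 x| <=
    K2 * Num.min (enorm y `^ r) 1.
  apply: sqnorm_le_min_powR => //; first by rewrite mulr_ge0.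
  move: (v0M (x + y)) (v0M (x - y)) (v0M x); rewrite !ler_norml; clear.
  by move=> /andP[? ?] /andP[? ?] /andP[? ?]; apply/andP; split; lra.
pose B := E * (K2 * C).
have B0 : 0 <= B by rewrite !mulr_ge0.
have e20 : 0 < e1 / (B + 1) by rewrite divr_gt0// ltr_wpDl.
have e2B : e1 / (B + 1) * B <= e1.
  by rewrite mulrAC ler_pdivrMr ?ltr_wpDl// ler_pM2l//; lra.
have [K3 K30 HK3] := Dmod _ e20.
have [K0 K00 HK0] := mod_u0 _ e10.
have EM0 : 0 <= E * Mv by exact: mulr_ge0.
have MB0 : 0 <= MD * B by exact: mulr_ge0.
have [L3 [tau2 [L30 tau20 tmod]]] := caputo_time_modulus alpha01 EM0 MB0 e10.
have KK0 : 0 <= E * (K0 + K3 * B) by rewrite mulr_ge0// addr_ge0// mulr_ge0.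
exists (E * (K0 + K3 * B) + L3), (Num.min tau1 tau2); split.
- by rewrite addr_ge0.
- by rewrite lt_min tau10.
move=> h tau w D N U /andP[t0]; rewrite le_min => /andP[tt1 tt2] NT w0 wfin wC HDD LD U0 solU.
have D0M n x : 0 <= D n x <= MD by exact: DM.
have D0 n x : 0 <= D n x by case/andP: (D0M n x).
have bv0 : fbounded v0 by exists Mv.
have [V V0 solV] := @L1_solution_exists R d alpha h tau w alpha01 t0 w0 wfin D v0 N D0 bv0.
have tt : 0 < tau <= tau1 by rewrite t0.
have [est1 est2] := est h tau w D N tt NT w0 wfin D0M.
have [bU HU] := solU; have [bV HV] := solV.
have LV n x : (n <= N)%N -> `|discrete_op h w (V n) x| <= B.
  apply: (est2 V (K2 * C)) => // {}x; rewrite V0.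
  apply: (@discrete_op_le _ _ _ _ w0 wfin v0 (fun y => Num.min (enorm y `^ r) 1)) => // y.
  by rewrite le_min powR_ge0 ge_min lexx orbT ler01.
have UV n x : (n <= N)%N -> `|U n x - V n x| <= E * (e1 + 0).
  apply: (est1 (fun n x => U n x - V n x)) => //.
  - by move=> k kN; apply: fboundedB; [exact: bU | exact: bV].
  - by move=> z; rewrite U0 V0 distrC.
  move=> k z kN; rewrite caputo_L1B HU// HV// discrete_opB//; [|exact: bU|exact: bV].
  by rewrite mulrBr subrr normr0.
have Vspace n x y : (n <= N)%N -> `|V n x - V n y| <=
    E * ((3 * e1 + K0 * sqnorm (x - y)) + (e1 / (B + 1) + K3 * sqnorm (x - y)) * B).
  move=> nN; pose p := x - y.
  have -> : V n x - V n y = V n (y + p) - V n y by rewrite /p [y + _]addrC subrK.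
  have [estp _] := est h tau w (fun n z => D n (z + p)) N tt NT w0 wfin
    (fun n z => D0M n (z + p)).
  apply: (estp (fun n z => V n (z + p) - V n z)) => //.
  - by rewrite mulr_ge0// addr_ge0 ?(ltW e20)// mulr_ge0// sqnorm_ge0.
  - by move=> k kN; apply: fboundedB; [apply: fbounded_comp|]; exact: bV.
  - move=> z; rewrite V0; have := v0u0 (z + p); have := v0u0 z; have := HK0 (z + p) z.
    rewrite [z + p - z]addrAC subrr add0r !ler_norml; clear.
    by move=> /andP[? ?] /andP[? ?] /andP[? ?]; apply/andP; split; lra.
  move=> k z kN; rewrite caputo_L1B !HV//.
  rewrite discrete_opB//; [|by apply: fbounded_comp; exact: bV|exact: bV].
  rewrite discrete_op_shift.
  set a := discrete_op _ _ _ _; set b := discrete_op _ _ _ _.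
  have -> : D k.+1 (z + p) * a - D k.+1 z * b - D k.+1 (z + p) * (a - b) =
    (D k.+1 (z + p) - D k.+1 z) * b by ring.
  rewrite normrM ler_pM//; last exact: LV.
  have := HK3 _ (HDD k.+1) (z + p) z.
  by rewrite [z + p - z]addrAC subrr add0r.
have Vtime n m y : (n <= N)%N -> (m <= N)%N ->
    `|V n y - V m y| <= e1 + L3 * `|n%:R * tau - m%:R * tau|.
  apply: (tmod tau N (V^~ y)); first by rewrite t0.
    move=> k kN; rewrite -[Mv]addr0; apply: (est1 V) => //.
      by move=> z; rewrite V0.
    by move=> j z jN; rewrite HV// subrr normr0.
  move=> k kN; rewrite HV// normrM ler_pM//; last exact: LV.
  by have /andP[? ?] := D0M k.+1 y; rewrite ger0_norm.
move=> n m x y nN mN.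
have -> : U n x - U m y = (U n x - V n x) + (V n x - V n y) + (V n y - V m y) - (U m y - V m y).
  by ring.
apply: le_trans (ler_normB _ _) _.
have h1 := UV n x nN; have h2 := UV m y mN.
have h3 := Vspace n x y nN; have h4 := Vtime n m y nN mN.
have h5 := ler_normD (U n x - V n x + (V n x - V n y)) (V n y - V m y).
have h6 := ler_normD (U n x - V n x) (V n x - V n y).
set s := sqnorm (x - y) in h3 *; set t := `|_ - _ * tau| in h4 *.
have s0 : 0 <= s by exact: sqnorm_ge0.
have t0' : 0 <= t by exact: normr_ge0.
have h7 : E * ((e1 / (B + 1) + K3 * s) * B) <= E * (e1 + K3 * B * s).
  by rewrite ler_wpM2l//; move: e2B; clear; lra.
have h8 : e1 * (6 * E + 1) = eps by rewrite divfK// gt_eqF// ltr_wpDl// mulr_ge0.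
have h9 : 0 <= E * (K0 + K3 * B) * t by exact: mulr_ge0.
have h10 : 0 <= L3 * s by exact: mulr_ge0.
move: h1 h2 h3 h4 h5 h6 h7 h8 h9 h10; clear; lra.
Qed.

End uniform_estimates.

(** * Compactness *)

Section ascoli.
Variables (R : realType) (X : topologicalType).

(** Compactness of [-M, M] yields a cluster point, and an ultrafilter contains each set or its
    complement, so a cluster point is already a limit. *)
Lemma ultra_real_cvg (G : set_system nat) (f : nat -> R) M : UltraFilter G ->
  (\forall j \near G, `|f j| <= M) ->
  exists2 l, `|l| <= M & forall eps, 0 < eps -> \forall j \near G, `|f j - l| <= eps.
Proof.
move=> GU fM.
have /= := @segment_compact R (- M) M (f @ G) _ _; case.
  by apply: filterS fM => j; rewrite /= in_itv/= -ler_norml.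
move=> l [lM clu]; exists l; first by rewrite ler_norml; move: lM; rewrite /= in_itv.
move=> eps eps0.
have [//|nG] := in_ultra_setVsetC [set j | `|f j - l| <= eps] GU.
have : (f @ G) [set y | ~ `|y - l| <= eps] by exact: nG.
move=> /clu /(_ (nbhsx_ballx l eps eps0)) [y [/= yl]].
by rewrite -ball_normE /= distrC => /ltW.
Qed.

(* The limit is taken along an ultrafilter, which avoids a diagonal extraction;
   equicontinuity makes the convergence uniform on compacts, and then indices
   phi m realising accuracy 1/(m+1) on the m-th compact can be picked. *)
Lemma ascoli_subsequence (A : set X) (K : nat -> set X) (F : nat -> X -> R) M :
  (\forall j \near \oo, forall z, A z -> `|F j z| <= M) ->
  (forall z, A z -> forall eps, 0 < eps -> \forall z' \near z & j \near \oo,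
     A z' -> `|F j z' - F j z| <= eps) ->
  (forall m, compact (K m)) -> (forall m, K m `<=` A) ->
  (forall z, A z -> exists2 V, nbhs z V &
     exists m0, forall m, (m0 <= m)%N -> V `&` A `<=` K m) ->
  exists u phi, [/\ Cb_on A u, forall m, (m <= phi m)%N &
    cvg_locally_uniformly A (fun m => F (phi m)) u].
Proof.
move=> FM Feq Kc KA Kex.
have [G [GU ooG]] := ultraFilterLemma (@eventually_filter).
have nearG (P : nat -> Prop) : (\forall j \near \oo, P j) -> \forall j \near G, P j.
  exact: ooG.
have /choice [u uP] : forall z, exists l, A z -> `|l| <= M /\
    forall eps, 0 < eps -> \forall j \near G, `|F j z - l| <= eps.
  move=> z; have [Az|nAz] := pselect (A z); last by exists 0.
  have [|l lM lG] := @ultra_real_cvg G (F^~ z) M GU; last by exists l.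
  by apply: nearG; apply: filterS FM => j; exact.
have ucont z eps : A z -> 0 < eps -> \forall z' \near z, A z' -> `|u z' - u z| <= eps.
  move=> Az eps0; have e3 : 0 < eps / 3 by rewrite divr_gt0.
  have [[V S] [/= zV ooS] VS] := Feq z Az _ e3.
  apply: filterS zV => z' Vz' Az'.
  have : \forall j \near G, [/\ S j, `|F j z' - u z'| <= eps / 3 & `|F j z - u z| <= eps / 3].
    near=> j; split; near: j; first exact: nearG.
      exact: (uP z' Az').2.
    exact: (uP z Az).2.
  move=> /filter_ex [j [Sj h1 h2]]; have := VS (z', j) (conj Vz' Sj) Az'; rewrite /= => h3.
  move: h1 h2 h3; rewrite !ler_norml => /andP[? ?] /andP[? ?] /andP[? ?].
  by apply/andP; split; lra.
have Kunif m eps : 0 < eps -> \forall j \near G, forall z, K m z -> `|F j z - u z| <= eps.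
  move=> eps0; have e3 : 0 < eps / 3 by rewrite divr_gt0.
  (* Near-covering form of compactness: an estimate valid around each point for [G]-many indices
     holds on all of [K m] for [G]-many indices. *)
  have cov := (compact_near_coveringP (K m)).1 (Kc m) nat G.
  suff HG : \forall j \near G, K m `<=` (fun z => A z -> `|F j z - u z| <= eps).
    by apply: filterS HG => j H z Kz; apply: (H z Kz); exact: KA Kz.
  apply: cov => z Kz; have Az := KA _ _ Kz.
  have [[V S] [/= zV ooS] VS] := Feq z Az _ e3.
  have h2 := (uP z Az).2 _ e3.
  have h3 := ucont z _ Az e3.
  exists (V `&` [set z' | A z' -> `|u z' - u z| <= eps / 3],
          S `&` [set j | `|F j z - u z| <= eps / 3]).
    split; first exact: filterI.
    by apply: filterI => //; exact: nearG.
  move=> [z' k] /= [[Vz' uz'] [Sk Fk]] Az'.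
  have h4 := VS (z', k) (conj Vz' Sk) Az'; have h5 := uz' Az'.
  move: h4 h5 Fk; rewrite /= !ler_norml => /andP[? ?] /andP[? ?] /andP[? ?].
  by apply/andP; split; lra.
have /choice [phi phiP] : forall m, exists k, (m <= k)%N /\
    forall z, K m z -> `|F k z - u z| <= m.+1%:R^-1.
  move=> m; have i0 : 0 < m.+1%:R^-1 :> R by rewrite invr_gt0.
  have : \forall k \near G, (m <= k)%N /\ forall z, K m z -> `|F k z - u z| <= m.+1%:R^-1.
    near=> k; split; near: k; last exact: Kunif.
    by apply: nearG; exact: nbhs_infty_ge.
  by move=> /filter_ex [k Hk]; exists k.
exists u, phi; split; last 2 first.
- by move=> m; have [] := phiP m.
- move=> z Az; have [V zV [m0 VK]] := Kex z Az; exists V => // P /=.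
  move=> /uniform_nbhs [E [entE EP]].
  rewrite -entourage_ballE in entE; case: entE => e /= e0 eE.
  near=> m; apply: EP => z' [Vz' Az']; apply: eE => /=.
  rewrite -ball_normE /= distrC.
  apply: le_lt_trans ((phiP m).2 z' _) _.
    by apply: (VK m); [near: m; exact: nbhs_infty_ge | split].
  by near: m; exact: near_infty_natSinv_lt (PosNum e0).
split.
  apply/subspace_continuousP => z Az; apply/cvgrPdist_le => eps eps0.
  rewrite near_withinE; apply: filterS (ucont z eps Az eps0) => z' H Az'.
  by rewrite distrC; exact: H.
apply: (@le_lt_trans _ _ M%:E); last by rewrite ltry.
apply: ge_ereal_sup => _ [z Az <-]; rewrite lee_fin; exact: (uP z Az).1.
Unshelve. all: by end_near.
Qed.

End ascoli.

(** * Application to the interpolated solutions *)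

Lemma near_sqnorm (R : realType) (d : nat) (x : 'rV[R]_d) (eps : R) : 0 < eps ->
  \forall y \near x, sqnorm (y - x) <= eps.
Proof.
move=> eps0; pose e := Num.min 1 (eps / d.+1%:R).
have e0 : 0 < e by rewrite lt_min ltr01 divr_gt0.
apply: filterS (nbhsx_ballx x e e0) => y [_ xy].
have ed : e * d.+1%:R <= eps by rewrite -ler_pdivlMr// ge_min lexx orbT.
have ee : e ^+ 2 <= e.
  by rewrite expr2 ger_pMr// ge_min lexx.
apply: (@le_trans _ _ (\sum_(i < d) e)).
  apply: ler_sum => i _; apply: le_trans ee.
  rewrite -[leLHS]real_normK ?num_real// lerXn2r// ?nnegrE ?(ltW e0)//.
  by have /ltW := xy 0 i; rewrite /= !mxE distrC.
rewrite sumr_const card_ord -mulr_natr; apply: le_trans ed.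
by rewrite ler_wpM2l ?(ltW e0)// ler_nat.
Qed.

Lemma time_interp_near_grid (R : realType) (d : nat) (T tau delta : R) (N : nat)
    (V : nat -> 'rV[R]_d -> R) (x : 'rV[R]_d) (t : R) :
  0 < tau -> N%:R * tau = T -> 0 <= t <= T -> 0 <= delta ->
  (forall k, (k < N)%N -> `|V k.+1 x - V k x| <= delta) ->
  exists k, [/\ (k <= N)%N, `|k%:R * tau - t| <= tau &
    `|time_interp tau V (x, t) - V k x| <= delta].
Proof.
move=> tau0 NT /andP[t0 tT] delta0 HV.
pose k := Num.truncn (t / tau); exists k.
have /andP[] := truncn_itv (divr_ge0 t0 (ltW tau0)).
rewrite -/k ler_pdivlMr// ltr_pdivrMr// -natr1 mulrDl mul1r => kt tk.
have kN : (k <= N)%N.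
  by rewrite -(ler_nat R) -(ler_pM2r tau0) NT; exact: le_trans tT.
split=> //.
  by rewrite distrC ger0_norm ?subr_ge0// lerBlDl; exact: ltW.
rewrite /time_interp /= -/k -natr1.
have -> : ((k%:R + 1) * tau - t) / tau * V k x + (t - k%:R * tau) / tau * V k.+1 x - V k x
    = (t - k%:R * tau) / tau * (V k.+1 x - V k x).
  by field; rewrite gt_eqF.
(* At t = T the index is [k = N] and the interpolant refers to [V N.+1], on which nothing is
   assumed; its coefficient is 0 there. *)
move: kN; rewrite leq_eqVlt => /predU1P[kN|kN].
  have -> : t = k%:R * tau.
    by apply/eqP; rewrite eq_le kt kN NT tT.
  by rewrite subrr !mul0r normr0.
rewrite normrM; apply: le_trans (HV _ kN); rewrite ler_piMl//.
rewrite ger0_norm; last by rewrite divr_ge0 ?(ltW tau0)// subr_ge0.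
by rewrite ler_pdivrMr// mul1r lerBlDl ltW.
Qed.

Lemma lty_le_EFin (R : realType) (s : \bar R) : (s < +oo)%E -> exists M : R, (s <= M%:E)%E.
Proof.
case: s => [r _|//|_]; first by exists r.
by exists 0; rewrite leNye.
Qed.

Lemma slab_exhaustion (R : realType) (d : nat) (T : R) (z : 'rV[R]_d * R) :
  exists2 V, nbhs z V & exists m0, forall m, (m0 <= m)%N ->
    V `&` slab d T `<=` [set x : 'rV[R]_d | forall i, `[- m%:R, m%:R]%classic (x ord0 i)] `*` `[0, T].
Proof.
case: z => x t; pose m0 := (Num.truncn (enorm x + 1)).+1.
exists [set z | ball x 1 z.1].
  exists (ball x 1, setT); last by move=> [y s] [].
  by split; [exact: nbhsx_ballx | exact: filterT].
exists m0 => m mm [y s] [[_ /= xy] [_ ts]]; split=> //= i.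
have : enorm x + 1 <= m%:R.
  apply: (@le_trans _ _ m0%:R); last by rewrite ler_nat.
  by rewrite ltW// truncnS_gt.
have := xy 0 i; rewrite /ball/= => /ltW h1 h2.
have := ler_coord_enorm x i; rewrite in_itv/= -ler_norml => h3.
have -> : y ord0 i = x 0 i - (x 0 i - y 0 i) by ring.
by apply: le_trans (ler_normB _ _) _; lra.
Qed.

Lemma compact_box_slab (R : realType) (d : nat) (T m : R) :
  compact ([set x : 'rV[R]_d | forall i, `[- m, m]%classic (x ord0 i)] `*` `[0, T]).
Proof.
apply: compact_setX; last exact: segment_compact.
by apply: (@rV_compact _ d (fun=> `[- m, m]%classic)) => i; exact: segment_compact.
Qed.

Theorem corollary1 (R : realType) (d : nat) (hd : (0 < d)%N)
  (alpha T r a : R)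
  (halpha : 0 < alpha < 1) (hT : 0 < T) (hr : 0 < r <= 2) (ha : 0 < a <= r)
  (omega : R -> 'rV[int]_d -> R)
  (omega_sym : forall h, 0 < h -> forall b, b != 0 -> omega h b = omega h (- b))
  (omega_ge0 : forall h, 0 < h -> forall b, b != 0 -> 0 <= omega h b)
  (omega_fin : forall h, 0 < h ->
     (\esum_(b in nonzero_lattice d) (omega h b)%:E < +oo)%E)
  (C : R) (hC : 0 < C)
  (omega_sup :
     (ereal_sup
        [set \esum_(b in nonzero_lattice d)
               (Num.min (enorm (lattice_pt h b) `^ r) 1 * omega h b)%R%:E
        | h in `]0%R, 1%R[] < C%:E)%E)
  (u0 : 'rV[R]_d -> R) (hu0 : Xspace a u0)
  (D : 'rV[R]_d -> R -> R)
  (D_X : Cb_time_X T r D) (D_Lip : Cb_space_Lip T D)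
  (D_ge0 : forall x t, t \in `[0, T] -> 0 <= D x t)
  (U : R -> R -> nat -> 'rV[R]_d -> R)
  (hU : forall h tau, 0 < h -> 0 < tau ->
     scheme_solution alpha T h tau (omega h) D u0 (U h tau)) :
  exists (u : 'rV[R]_d * R -> R) (h tau : nat -> R),
    [/\ Cb_on (slab d T) u,
        forall j, 0 < h j /\ 0 < tau j,
        h @ \oo --> (0 : R),
        tau @ \oo --> (0 : R) &
        cvg_locally_uniformly (slab d T)
          (fun j => time_interp (tau j) (U (h j) (tau j))) u].
Proof.
have /andP[r0 r2] := hr; have /andP[a0 ar] := ha.
have r02 : 0 <= r <= 2 by rewrite ltW.
have a02 : 0 < a <= 2 by rewrite a0 (le_trans ar).
have [M0 HM0] := lty_le_EFin hu0.2.
have [u0M u0h _] := Xnorm_bounds hd a02 hu0.1 HM0.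
have M00 : 0 <= M0 by apply: le_trans (u0M 0).
have bu0 : fbounded u0 by exists M0.
have mod_u0 : quad_modulus u0.
  have p0 : 0 < Num.min a 1 by rewrite lt_min a0 ltr01.
  move=> e e0; have [K K0 HK] := holder_quad_modulus d M00 p0 e0.
  by exists K => // x y; exact: HK.
have [DX DXsup _] := D_X; have [MD HMD] := lty_le_EFin DXsup.
have DXle t : t \in `[0, T] -> (Xnorm r (D^~ t) <= MD%:E)%E.
  by move=> tT; apply: le_trans HMD; apply: ereal_sup_ubound; exists t.
have Dbounds t (tT : t \in `[0, T]) := Xnorm_bounds hd hr (DX t tT).1 (DXle t tT).
have T0T : 0 \in `[0, T] by rewrite in_itv/= lexx ltW.
have MD0 : 0 <= MD by have [H _ _] := Dbounds _ T0T; apply: le_trans (H 0).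
pose DD := [set f : 'rV[R]_d -> R | exists2 t, t \in `[0, T] & f = D^~ t].
have DDM f : DD f -> forall x, 0 <= f x <= MD.
  move=> [t tT ->] x; rewrite D_ge0//=; have [H _ _] := Dbounds t tT.
  exact: le_trans (ler_norm _) (H x).
have DDmod (e : R) : 0 < e -> exists2 K, 0 <= K &
    forall f, DD f -> forall x y, `|f x - f y| <= e + K * sqnorm (x - y).
  have p0 : 0 < Num.min r 1 by rewrite lt_min r0 ltr01.
  move=> e0; have [K K0 HK] := holder_quad_modulus d MD0 p0 e0.
  by exists K => // f [t tT ->]; have [H1 H2 _] := Dbounds t tT; exact: HK.
have w_sup h : 0 < h < 1 -> (\esum_(b in nonzero_lattice d)
    (Num.min (enorm (lattice_pt h b) `^ r) 1 * omega h b)%:E <= C%:E)%E.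
  move=> h01; apply: le_trans (ltW omega_sup); apply: ereal_sup_ubound.
  by exists h => //=; rewrite in_itv.
pose C0 := (4 + 2 * d%:R) * MD * C.
have Cd0 : 0 <= (4 + 2 * d%:R) * MD by rewrite mulr_ge0// addr_ge0// mulr_ge0.
have C00 : 0 <= C0 by rewrite mulr_ge0// ltW.
have LD h f : 0 < h < 1 -> DD f -> forall x, `|discrete_op h (omega h) f x| <= C0.
  move=> h01 DDf x; have [t tT Ef] := DDf; have [H1 _ H3] := Dbounds t tT.
  have h0 : 0 < h by case/andP: h01.
  apply: (@discrete_op_le _ _ h _ (omega_ge0 h h0) (omega_fin h h0) f
    (fun y => Num.min (enorm y `^ r) 1)) => //.
  - by exists MD => y; rewrite Ef.
  - by move=> y; rewrite le_min powR_ge0 ge_min lexx orbT ler01.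
  - exact: w_sup.
  - by move=> y; rewrite Ef; exact: H3.
(* The factor 1/2 keeps the mesh size inside ]0, 1[ already at j = 0. The step [tt j], equal to T /
   (j + 1), makes T a grid time, reached after exactly [j.+1] steps. *)
pose hh (j : nat) : R := harmonic j * 2^-1.
pose tt (j : nat) : R := harmonic j * T.
have harm0 j : 0 < harmonic j :> R by rewrite invr_gt0.
have hh0 j : 0 < hh j by rewrite mulr_gt0.
have hh1 j : 0 < hh j < 1.
  rewrite hh0 /= /hh; apply: (@le_lt_trans _ _ (1 * 2^-1)); last by rewrite mul1r invf_lt1// ltr1n.
  by rewrite ler_pM2r// invf_le1// ler1n.
have tt0 j : 0 < tt j by rewrite mulr_gt0.
have ttT j : j.+1%:R * tt j = T by rewrite /tt mulrA mulfV ?mul1r.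
have hh_cvg : hh @ \oo --> (0 : R).
  by rewrite -[X in _ --> X](mul0r 2^-1); apply: cvgM; [exact: cvg_harmonic | exact: cvg_cst].
have tt_cvg : tt @ \oo --> (0 : R).
  by rewrite -[X in _ --> X](mul0r T); apply: cvgM; [exact: cvg_harmonic | exact: cvg_cst].
have tt_small (e : R) : 0 < e -> \forall j \near \oo, tt j <= e.
  move=> e0; move/cvgrPdist_le : tt_cvg => /(_ e e0); apply: filterS => j.
  by rewrite sub0r normrN ger0_norm// ltW.
pose Ds j n x := D x (Num.min (n%:R * tt j) T).
have DsDD j n : DD (Ds j n).
  exists (Num.min (n%:R * tt j) T) => //.
  by rewrite in_itv/= le_min mulr_ge0 ?(ltW (tt0 j))//= (ltW hT) ge_min lexx orbT.
pose UU j := U (hh j) (tt j).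
have U0 j : UU j 0%N = u0 by have [] := hU _ _ (hh0 j) (tt0 j).
have solU j : L1_solution alpha (hh j) (tt j) (omega (hh j)) (Ds j) j.+1 (UU j).
  have [_ HU] := hU _ _ (hh0 j) (tt0 j).
  have ltT n : (n < j.+1)%N -> (n.+1 - 1)%N%:R * tt j < T.
    by move=> nj; rewrite subn1/= -[X in _ < X](ttT j) ltr_pM2r// ltr_nat.
  split=> [[_|n nj]|n x nj].
  - by rewrite U0.
  - by apply: fbounded_sup_norm; have [] := HU n.+1 isT (ltT n nj).
  - by have [_ ->] := HU n.+1 isT (ltT n nj).
pose F j := time_interp (tt j) (UU j).
have slabP z : slab d T z -> 0 <= z.2 <= T by case=> _ /=; rewrite in_itv.
have FM : exists M, \forall j \near \oo, forall z, slab d T z -> `|F j z| <= M.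
  have [M [tau0 [M0' tau00 HM]]] := @scheme_bound R d alpha T halpha MD M0.
  exists (3 * M); apply: filterS (tt_small _ tau00) => j tj [x t] /slabP tT.
  have bound n : (n <= j.+1)%N -> `|UU j n x| <= M.
    apply: (HM (hh j) (tt j) (omega (hh j)) (Ds j)) => //.
    - by rewrite tt0.
    - by rewrite ttT.
    - exact: omega_ge0.
    - exact: omega_fin.
    - by move=> n' y; exact: DDM.
    - by move=> y; rewrite U0.
  have [||k [kN _ Hk]] := @time_interp_near_grid R d T (tt j) (2 * M) j.+1 (UU j) x t (tt0 j) (ttT j) tT.
  - by rewrite mulr_ge0.
  - move=> k kj; apply: le_trans (ler_normB _ _) _.
    by move: (bound k.+1 kj) (bound k (ltnW kj)); clear; lra.
  have := bound k kN; move: Hk; rewrite -/(F j) !ler_norml; clear.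
  by move=> /andP[? ?] /andP[? ?]; apply/andP; split; lra.
have Feq z : slab d T z -> forall eps, 0 < eps -> \forall z' \near z & j \near \oo,
    slab d T z' -> `|F j z' - F j z| <= eps.
  (* Each of the two interpolants is within [2 * e] of a grid value, and these grid values differ by
     at most [e + 4 * L * del <= 5 * e], for a total of [9 * e]. *)
  case: z => x t /slabP /= tT eps eps0; pose e := eps / 10.
  have e0 : 0 < e by rewrite divr_gt0.
  have [L [tau0 [L0 tau00 HL]]] :=
    @scheme_equicontinuity R d alpha T halpha r MD C0 C DD u0 e r02 C00 (ltW hC)
      bu0 mod_u0 DDM DDmod e0.
  pose del := e / (L + 1); have del0 : 0 < del by rewrite divr_gt0// ltr_wpDl.
  have Ldel : L * del <= e.
    by rewrite /del mulrCA ger_pMr// ler_pdivrMr ?ltr_wpDl// mul1r lerDl.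
  exists ([set z' : 'rV[R]_d * R | sqnorm (z'.1 - x) <= del /\ `|z'.2 - t| <= del],
          [set j | tt j <= tau0 /\ tt j <= del]).
    split=> /=; last first.
      by apply: filterI; exact: tt_small.
    exists ([set y | sqnorm (y - x) <= del], [set s | `|s - t| <= del]); last by move=> [y s] [].
    split; first exact: near_sqnorm.
    apply: filterS (nbhsx_ballx t del del0) => s /=.
    by rewrite -ball_normE /= distrC => /ltW.
  move=> [[y s] j] /= [[xy st] [tj1 tj2]] /slabP /= sT.
  have equi n m y1 y2 : (n <= j.+1)%N -> (m <= j.+1)%N ->
    `|UU j n y1 - UU j m y2| <= e + L * (sqnorm (y1 - y2) + `|n%:R * tt j - m%:R * tt j|).
    apply: (HL (hh j) (tt j) (omega (hh j)) (Ds j)) => //.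
    - by rewrite tt0.
    - by rewrite ttT.
    - exact: omega_ge0.
    - exact: omega_fin.
    - exact: w_sup.
    - by move=> n' y'; apply: LD.
  have step y1 k : (k < j.+1)%N -> `|UU j k.+1 y1 - UU j k y1| <= 2 * e.
    move=> kj; apply: le_trans (equi _ _ _ _ kj (ltnW kj)) _.
    rewrite subrr (_ : sqnorm 0 = 0); last first.
      by rewrite /sqnorm big1// => i _; rewrite mxE expr0n.
    have -> : k.+1%:R * tt j - k%:R * tt j = tt j by rewrite -natr1; ring.
    rewrite add0r (ger0_norm (ltW (tt0 j))).
    by move: (ler_wpM2l L0 tj2) Ldel; clear; lra.
  have e20 : 0 <= 2 * e by rewrite mulr_ge0// ltW.
  have [k [kN kt Hk]] := time_interp_near_grid (tt0 j) (ttT j) tT e20 (step x).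
  have [k' [kN' kt' Hk']] := time_interp_near_grid (tt0 j) (ttT j) sT e20 (step y).
  have Hkk := equi k' k y x kN' kN.
  have Hgap : `|k'%:R * tt j - k%:R * tt j| <= 3 * del.
    move: kt kt' st tj2; rewrite !ler_norml; clear.
    by move=> /andP[? ?] /andP[? ?] /andP[? ?] ?; apply/andP; split; lra.
  have Hsum : L * (sqnorm (y - x) + `|k'%:R * tt j - k%:R * tt j|) <= 4 * e.
    apply: (@le_trans _ _ (L * (4 * del))); last by move: Ldel; clear; lra.
    by rewrite ler_wpM2l//; move: xy Hgap; clear; lra.
  have {}Hkk := le_trans Hkk (lerD (lexx e) Hsum).
  have eE : eps = 10 * e by rewrite /e mulrC divfK.
  rewrite -/(F j) in Hk; rewrite -/(F j) in Hk'.
  move: Hk Hk' Hkk; rewrite eE !ler_norml; clear.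
  by move=> /andP[? ?] /andP[? ?] /andP[? ?]; apply/andP; split; lra.
have [M HM] := FM.
have box_slab (m : nat) : [set x : 'rV[R]_d | forall i,
    `[- m%:R, m%:R]%classic (x ord0 i)] `*` `[0, T] `<=` slab d T.
  by move=> z [_ zT].
have [u [phi [Cu phi_ge Fu]]] := ascoli_subsequence HM Feq
  (fun m => @compact_box_slab R d T m%:R) box_slab (fun z _ => slab_exhaustion T z).
have phi_cvg : phi @ \oo --> \oo.
  by move=> P [n _ Hn]; exists n => // m /= nm; apply: Hn; exact: leq_trans nm (phi_ge m).
exists u, (hh \o phi), (tt \o phi); split=> //.
- by move=> j; split; [exact: hh0 | exact: tt0].
- exact: cvg_comp phi_cvg hh_cvg.
- exact: cvg_comp phi_cvg tt_cvg.
Qed.
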